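(* Let $k$ be a field, let $\mathcal V$ be a dualizing $k$-variety and let $\mathcal C$ be a (Krull-Schmidt) functorially finite exact subcategory of $\mathcal V\text{-}\mathrm{mod}$ which is a stably $d$-Calabi-Yau Frobenius category. Let $\langle 1\rangle$ be the suspension functor of the stable category $\overline{\mathcal S(\mathcal C)}$. Then the Auslander-Reiten translation $\tau_{\mathcal S}:\overline{\mathcal S(\mathcal C)}\to\overline{\mathcal S(\mathcal C)}$ satisfies $$\tau_{\mathcal S}^6 f\cong f\langle 6d-4\rangle$$ for every object $f$ in $\overline{\mathcal S(\mathcal C)}$.
   Context: **Dualizing varieties.** $D=\operatorname{Hom}_k(-,k)$. For a $\operatorname{Hom}$-finite $k$-linear Krull-Schmidt category $\mathcal V$, $\mathcal V\text{-}\mathrm{mod}$ is the category of finitely presented contravariant additive functors from $\mathcal V$ to abelian groups. $\mathcal V$ is a dualizing $k$-variety if $F\mapsto D\circ F$ induces dualities $\mathcal V\text{-}\mathrm{mod}\to\mathcal V^{\rm op}\text{-}\mathrm{mod}$ and $\mathcal V^{\rm op}\text{-}\mathrm{mod}\to\mathcal V\text{-}\mathrm{mod}$. Then $\mathcal V\text{-}\mathrm{mod}$ is abelian. **Exact and Frobenius categories.** Exact categories are in the sense of Quillen (conflations, inflations, deflations). An exact subcategory is a full extension-closed subcategory whose conflations are the ambient ones with all terms in it. An object $P$ is $\operatorname{Ext}$-projective if $\operatorname{Ext}^1(P,-)=0$; $\operatorname{Ext}$-injective is dual. A Frobenius category is an exact category with enough $\operatorname{Ext}$-projectives and enough $\operatorname{Ext}$-injectives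 in which these two classes coincide. Its stable category $\underline{\mathcal C}=\overline{\mathcal C}$ (the quotient by morphisms factoring through $\operatorname{Ext}$-injectives) is triangulated; write $[1]$ for the suspension of $\overline{\mathcal C}$. A $k$-linear $\operatorname{Hom}$-finite triangulated category $\mathcal T$ is $d$-Calabi-Yau if there are bifunctorial isomorphisms $\operatorname{Hom}(A,B)\cong D\operatorname{Hom}(B,A[d])$ for all $A,B\in\mathcal T$ (i.e. $[d]$ is a Serre functor). A $k$-linear $\operatorname{Hom}$-finite Frobenius category $\mathcal C$ is stably $d$-Calabi-Yau if $\underline{\mathcal C}$ is $d$-Calabi-Yau. **Monomorphism category.** $\mathcal S(\mathcal C)$ is the category whose objects are the inflations in $\mathcal C$ and whose morphisms are commutative squares, with the degreewise exact structure (a sequence is a conflation iff both the row of sources and the row of targets are conflations in $\mathcal C$). If $\mathcal C$ is Frobenius and extension-closed in an abelian category, $\mathcal S(\mathcal C)$ is Frobenius, so $\overline{\mathcal S(\mathcal C)}$ is triangulated, with suspension $\langle 1\rangle$; $\langle n\rangle$ is its $n$-th power. $\mathcal S(\mathcal C)$ has an Auslander-Reiten-Serre duality, i.e. an equivalence $\tau_{\mathcal S}:\overline{\mathcal S(\mathcal C)}=\underline{\mathcal S(\mathcal C)}\to\overline{\mathcal S(\mathcal C)}$ (the Auslander-Reiten translation) with binatural isomorphisms $\operatorname{Hom}_{\underline{\mathcal S(\mathcal C)}}(f,g)\cong D\operatorname{Ext}^1_{\mathcal S(\mathcal C)}(g,\tau_{\mathcal S}f)$. *)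

(* Defs.v *)
From HB Require Import structures.
From mathcomp Require Import all_boot all_algebra.
From mathcomp Require Import boolp.

Set Implicit Arguments.
Unset Strict Implicit.
Unset Printing Implicit Defensive.

Import GRing.Theory.
Local Open Scope ring_scope.
Local Open Scope quotient_scope.

(* A [k]-linear category on the type of objects [T].  Keeping [T] outside of the
record lets the same record be used for a small category and for its (large)
functor category: the universe of [T] is only constrained where a construction
needs smallness. *)

Record lincat (k : fieldType) (T : Type) := LinCat {
  Hom : T -> T -> lmodType k;
  idm : forall X, Hom X X;
  comp : forall X Y Z, Hom Y Z -> Hom X Y -> Hom X Z;
  comp_linr : forall X Y Z (g : Hom Y Z), linear (@comp X Y Z g);
  comp_linl : forall X Y Z (f : Hom X Y), linear (fun g : Hom Y Z => comp g f);
  comp1m : forall X Y (f : Hom X Y), comp (idm Y) f = f;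
  compm1 : forall X Y (f : Hom X Y), comp f (idm X) = f;
  compA : forall X Y Z W (h : Hom Z W) (g : Hom Y Z) (f : Hom X Y),
    comp h (comp g f) = comp (comp h g) f }.

Arguments idm {k T} _ _.
Arguments comp {k T} _ {X Y Z} _ _.

Notation "g ∘ f" := (comp _ g f) (at level 40, left associativity).

Section CompTheory.
Variables (k : fieldType) (T : Type) (C : lincat k T).
Implicit Types X Y Z : T.

Lemma comp0m X Y Z (f : Hom C X Y) : (0 : Hom C Y Z) ∘ f = 0.
Proof. by have /= := @comp_linl _ _ C X Y Z f (-1) 0 0; rewrite !scaleN1r !addNr. Qed.

Lemma compm0 X Y Z (g : Hom C Y Z) : g ∘ (0 : Hom C X Y) = 0.
Proof. by have /= := @comp_linr _ _ C X Y Z g (-1) 0 0; rewrite !scaleN1r !addNr. Qed.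

Lemma compDl X Y Z (f : Hom C X Y) (g h : Hom C Y Z) :
  (g + h) ∘ f = g ∘ f + h ∘ f.
Proof. by have /= := @comp_linl _ _ C X Y Z f 1 g h; rewrite !scale1r. Qed.

Lemma compDr X Y Z (f h : Hom C X Y) (g : Hom C Y Z) :
  g ∘ (f + h) = g ∘ f + g ∘ h.
Proof. by have /= := @comp_linr _ _ C X Y Z g 1 f h; rewrite !scale1r. Qed.

Lemma compZl X Y Z a (f : Hom C X Y) (g : Hom C Y Z) :
  (a *: g) ∘ f = a *: (g ∘ f).
Proof. by have /= := @comp_linl _ _ C X Y Z f a g 0; rewrite !addr0 comp0m addr0. Qed.

Lemma compZr X Y Z a (f : Hom C X Y) (g : Hom C Y Z) :
  g ∘ (a *: f) = a *: (g ∘ f).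
Proof. by have /= := @comp_linr _ _ C X Y Z g a f 0; rewrite !addr0 compm0 addr0. Qed.

End CompTheory.

Definition op (k : fieldType) (T : Type) (C : lincat k T) : lincat k T :=
  @LinCat k T (fun X Y => Hom C Y X) (idm C) (fun X Y Z g f => comp C f g)
    (fun X Y Z g => @comp_linl k T C Z Y X g)
    (fun X Y Z f => @comp_linr k T C Z Y X f)
    (fun X Y f => @compm1 k T C Y X f)
    (fun X Y f => @comp1m k T C Y X f)
    (fun X Y Z W h g f => esym (@compA k T C W Z Y X f g h)).

Definition full (k : fieldType) (T : Type) (C : lincat k T) (P : T -> Prop) :
    lincat k {X : T | P X} :=
  @LinCat k {X : T | P X} (fun X Y => Hom C (sval X) (sval Y))
    (fun X => idm C (sval X)) (fun X Y Z g f => comp C g f)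
    (fun X Y Z => @comp_linr k T C (sval X) (sval Y) (sval Z))
    (fun X Y Z => @comp_linl k T C (sval X) (sval Y) (sval Z))
    (fun X Y => @comp1m k T C (sval X) (sval Y))
    (fun X Y => @compm1 k T C (sval X) (sval Y))
    (fun X Y Z W => @compA k T C (sval X) (sval Y) (sval Z) (sval W)).

Section Categories.
Variables (k : fieldType) (T : Type) (C : lincat k T).
Implicit Types X Y Z : T.

Definition is_inverse X Y (f : Hom C X Y) (g : Hom C Y X) : Prop :=
  g ∘ f = idm C X /\ f ∘ g = idm C Y.

Definition is_iso X Y (f : Hom C X Y) : Prop := exists g, is_inverse f g.

Definition isomorphic X Y : Prop := exists f : Hom C X Y, is_iso f.

Definition is_zero X : Prop :=
  (forall Y (f : Hom C X Y), f = 0) /\ (forall Y (f : Hom C Y X), f = 0).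

Record biprod X Y := Biprod {
  bsum : T;
  bin1 : Hom C X bsum;
  bin2 : Hom C Y bsum;
  bpr1 : Hom C bsum X;
  bpr2 : Hom C bsum Y;
  bpr1in1 : bpr1 ∘ bin1 = idm C X;
  bpr2in2 : bpr2 ∘ bin2 = idm C Y;
  bpr1in2 : bpr1 ∘ bin2 = 0;
  bpr2in1 : bpr2 ∘ bin1 = 0;
  bsumE : bin1 ∘ bpr1 + bin2 ∘ bpr2 = idm C bsum }.

Definition additive_cat : Prop :=
  (exists X, is_zero X) /\ (forall X Y, inhabited (biprod X Y)).

Definition direct_sum n (A : 'I_n -> T) X : Prop :=
  exists (i : forall j, Hom C (A j) X) (p : forall j, Hom C X (A j)),
    [/\ forall j, p j ∘ i j = idm C (A j),
        forall j l, j != l -> p j ∘ i l = 0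
      & \sum_j i j ∘ p j = idm C X].

Definition local_end X : Prop :=
  idm C X <> 0 /\ forall a : Hom C X X, is_iso a \/ is_iso (idm C X - a).

Definition krull_schmidt : Prop :=
  additive_cat /\
  forall X, exists n (A : 'I_n -> T),
    (forall j, local_end (A j)) /\ direct_sum A X.

Definition hom_finite : Prop :=
  forall X Y, exists n (b : 'I_n -> Hom C X Y),
    forall f, exists c : 'I_n -> k, f = \sum_j c j *: b j.

Definition is_kernel X Y Z (i : Hom C X Y) (p : Hom C Y Z) : Prop :=
  p ∘ i = 0 /\
  forall W (f : Hom C W Y), p ∘ f = 0 -> exists! g : Hom C W X, i ∘ g = f.

Definition is_cokernel X Y Z (i : Hom C X Y) (p : Hom C Y Z) : Prop :=
  p ∘ i = 0 /\
  forall W (f : Hom C Y W), f ∘ i = 0 -> exists! g : Hom C Z W, g ∘ p = f.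

(* In an abelian category these are the short exact sequences. *)
Definition kercoker X Y Z (i : Hom C X Y) (p : Hom C Y Z) : Prop :=
  is_kernel i p /\ is_cokernel i p.

Definition is_pushout X Y X' Y' (i : Hom C X Y) (f : Hom C X X')
    (g : Hom C Y Y') (j : Hom C X' Y') : Prop :=
  g ∘ i = j ∘ f /\
  forall W (u : Hom C Y W) (v : Hom C X' W), u ∘ i = v ∘ f ->
    exists! w : Hom C Y' W, w ∘ g = u /\ w ∘ j = v.

Definition is_pullback X Y X' Y' (i : Hom C X Y) (f : Hom C X X')
    (g : Hom C Y Y') (j : Hom C X' Y') : Prop :=
  g ∘ i = j ∘ f /\
  forall W (u : Hom C W Y) (v : Hom C W X'), g ∘ u = j ∘ v ->
    exists! w : Hom C W X, i ∘ w = u /\ f ∘ w = v.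

Definition contravariantly_finite (P : T -> Prop) : Prop :=
  forall X, exists A (f : Hom C A X), P A /\
    forall B (g : Hom C B X), P B -> exists h : Hom C B A, f ∘ h = g.

Definition covariantly_finite (P : T -> Prop) : Prop :=
  forall X, exists A (f : Hom C X A), P A /\
    forall B (g : Hom C X B), P B -> exists h : Hom C A B, h ∘ f = g.

Definition functorially_finite (P : T -> Prop) : Prop :=
  contravariantly_finite P /\ covariantly_finite P.

End Categories.

Record lfunctor (k : fieldType) (T U : Type) (C : lincat k T) (D : lincat k U) :=
  LFunctor {
    fob :> T -> U;
    fhom : forall X Y, Hom C X Y -> Hom D (fob X) (fob Y);
    fhom_lin : forall X Y, linear (@fhom X Y);
    fhom1 : forall X, fhom (idm C X) = idm D (fob X);
    fhomM : forall X Y Z (g : Hom C Y Z) (f : Hom C X Y),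
      fhom (g ∘ f) = fhom g ∘ fhom f }.

Section Functors.
Variables (k : fieldType) (T U : Type) (C : lincat k T) (D : lincat k U).

Definition restricts_to_equivalence (F : lfunctor C D)
    (P : T -> Prop) (Q : U -> Prop) : Prop :=
  [/\ forall X, P X -> Q (F X),
      forall X Y, P X -> P Y -> bijective (@fhom _ _ _ _ _ F X Y)
    & forall Y, Q Y -> exists X, P X /\ isomorphic D (F X) Y].

Definition is_equivalence (F : lfunctor C D) : Prop :=
  restricts_to_equivalence F (fun=> True) (fun=> True).

Definition naturally_isomorphic (F G : lfunctor C D) : Prop :=
  exists e : forall X, Hom D (F X) (G X),
    (forall X, is_iso (e X)) /\
    (forall X Y (f : Hom C X Y), e Y ∘ fhom F f = fhom G f ∘ e X).

End Functors.

Definition fid (k : fieldType) (T : Type) (C : lincat k T) : lfunctor C C :=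
  @LFunctor k T T C C id (fun X Y f => f) (fun X Y a f g => erefl)
    (fun X => erefl) (fun X Y Z g f => erefl).

Section FunctorComp.
Variables (k : fieldType) (T U W : Type).
Variables (C : lincat k T) (D : lincat k U) (E : lincat k W).
Variables (G : lfunctor D E) (F : lfunctor C D).

Fact fcomp_lin X Y : linear (fun f : Hom C X Y => fhom G (fhom F f)).
Proof. by move=> a f g; rewrite fhom_lin fhom_lin. Qed.

Fact fcomp1 X : fhom G (fhom F (idm C X)) = idm E (G (F X)).
Proof. by rewrite !fhom1. Qed.

Fact fcompM X Y Z (g : Hom C Y Z) (f : Hom C X Y) :
  fhom G (fhom F (g ∘ f)) = fhom G (fhom F g) ∘ fhom G (fhom F f).
Proof. by rewrite !fhomM. Qed.

Definition fcomp : lfunctor C E := LFunctor fcomp_lin fcomp1 fcompM.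

End FunctorComp.

Fixpoint fiter (k : fieldType) (T : Type) (C : lincat k T) (n : nat)
    (F : lfunctor C C) : lfunctor C C :=
  if n is m.+1 then fcomp F (fiter m F) else fid C.

Section Dual.
Variables (k : fieldType) (U : lmodType k).

Record dual := Dual { dfun :> U -> k; dfunP : scalar dfun }.

Lemma dualP (f g : dual) : f =1 g -> f = g.
Proof.
case: f g => f fP [g gP] /= /funext fg; case: _ / fg gP => gP.
by rewrite (Prop_irrelevance fP gP).
Qed.

Lemma dualB (f : dual) x y : f (x - y) = f x - f y.
Proof. by rewrite [x - y]addrC -scaleN1r (dfunP f) mulN1r addrC. Qed.

Lemma dualZ (f : dual) a x : f (a *: x) = a * f x.
Proof.
have f0 : f 0 = 0 by rewrite -(subrr 0) dualB subrr.
by rewrite -[a *: x]addr0 (dfunP f) f0 addr0.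
Qed.

Fact dzero_subproof : scalar (fun _ : U => 0 : k).
Proof. by move=> a x y; rewrite mulr0 addr0. Qed.
Fact dopp_subproof (f : dual) : scalar (fun x => - f x).
Proof. by move=> a x y; rewrite (dfunP f) opprD mulrN. Qed.
Fact dadd_subproof (f g : dual) : scalar (fun x => f x + g x).
Proof. by move=> a x y; rewrite (dfunP f) (dfunP g) mulrDr addrACA. Qed.
Fact dscale_subproof (b : k) (f : dual) : scalar (fun x => b * f x).
Proof. by move=> a x y; rewrite (dfunP f) mulrDr mulrCA. Qed.

HB.instance Definition _ := gen_eqMixin dual.
HB.instance Definition _ := gen_choiceMixin dual.

Fact daddA : associative (fun f g => Dual (dadd_subproof f g)).
Proof. by move=> f g h; apply/dualP => x /=; rewrite addrA. Qed.
Fact daddC : commutative (fun f g => Dual (dadd_subproof f g)).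
Proof. by move=> f g; apply/dualP => x /=; rewrite addrC. Qed.
Fact dadd0 :
  left_id (Dual dzero_subproof) (fun f g => Dual (dadd_subproof f g)).
Proof. by move=> f; apply/dualP => x /=; rewrite add0r. Qed.
Fact daddN :
  left_inverse (Dual dzero_subproof) (fun f => Dual (dopp_subproof f))
    (fun f g => Dual (dadd_subproof f g)).
Proof. by move=> f; apply/dualP => x /=; rewrite addNr. Qed.

HB.instance Definition _ := GRing.isZmodule.Build dual daddA daddC dadd0 daddN.

Fact dscaleA a b (f : dual) :
  Dual (dscale_subproof a (Dual (dscale_subproof b f)))
  = Dual (dscale_subproof (a * b) f).
Proof. by apply/dualP => x /=; rewrite mulrA. Qed.
Fact dscale1 : left_id 1 (fun a (f : dual) => Dual (dscale_subproof a f)).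
Proof. by move=> f; apply/dualP => x /=; rewrite mul1r. Qed.
Fact dscaleDr :
  right_distributive (fun a (f : dual) => Dual (dscale_subproof a f)) +%R.
Proof. by move=> a f g; apply/dualP => x /=; rewrite mulrDr. Qed.
Fact dscaleDl (f : dual) :
  {morph (fun a => Dual (dscale_subproof a f)) : a b / a + b}.
Proof. by move=> a b; apply/dualP => x /=; rewrite mulrDl. Qed.

HB.instance Definition _ :=
  GRing.Zmodule_isLmodule.Build k dual dscaleA dscale1 dscaleDr dscaleDl.

End Dual.

Section AdditiveFunctors.
Variables (k : fieldType) (T : Type) (V : lincat k T).

Record cofun := Cofun {
  cob :> T -> zmodType;
  cmap : forall X Y, Hom V X Y -> cob Y -> cob X;
  cmapB : forall X Y (f : Hom V X Y), zmod_morphism (cmap f);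
  cmapBf : forall X Y (f g : Hom V X Y) x, cmap (f - g) x = cmap f x - cmap g x;
  cmap1 : forall X x, cmap (idm V X) x = x;
  cmapM : forall X Y Z (g : Hom V Y Z) (f : Hom V X Y) x,
    cmap (g ∘ f) x = cmap f (cmap g x) }.

Lemma cmap0 (F : cofun) X Y (f : Hom V X Y) : cmap f (0 : F Y) = 0.
Proof. by rewrite -(subrr (0 : F Y)) cmapB subrr. Qed.

Lemma cmapD (F : cofun) X Y (f : Hom V X Y) (x y : F Y) :
  cmap f (x + y) = cmap f x + cmap f y.
Proof. by rewrite -{1}(opprK y) -(sub0r y) cmapB cmapB cmap0 sub0r opprK. Qed.

Lemma cmapDf (F : cofun) X Y (f g : Hom V X Y) (x : F Y) :
  cmap (f + g) x = cmap f x + cmap g x.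
Proof.
have c0 : cmap (0 : Hom V X Y) x = 0 by rewrite -(subrr (0 : Hom V X Y)) cmapBf subrr.
by rewrite -{1}(opprK g) -(sub0r g) cmapBf cmapBf c0 sub0r opprK.
Qed.

(* The [k]-module structure induced on the values of an additive functor by
   [k -> End X]. *)
Definition kval (F : cofun) (X : T) : Type := F X.

Section KVal.
Variables (F : cofun) (X : T).

HB.instance Definition _ := GRing.Zmodule.on (kval F X).

Definition kact (a : k) (x : kval F X) : kval F X := cmap (a *: idm V X) x.

Fact kactA a b x : kact a (kact b x) = kact (a * b) x.
Proof. by rewrite /kact -cmapM compZl comp1m scalerA mulrC. Qed.
Fact kact1 : left_id 1 kact.
Proof. by move=> x; rewrite /kact scale1r cmap1. Qed.
Fact kactDr : right_distributive kact +%R.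
Proof. by move=> a x y; rewrite /kact cmapD. Qed.
Fact kactDl x : {morph kact^~ x : a b / a + b}.
Proof. by move=> a b; rewrite /kact scalerDl cmapDf. Qed.

HB.instance Definition _ :=
  GRing.Zmodule_isLmodule.Build k (kval F X) kactA kact1 kactDr kactDl.

End KVal.

Lemma cmapZ (F : cofun) X Y (f : Hom V X Y) a (x : kval F Y) :
  cmap f (a *: x) = a *: (cmap f x : kval F X).
Proof. by rewrite /GRing.scale /= /kact -!cmapM compZl comp1m compZr compm1. Qed.

Record nattrans (F G : cofun) := NatTrans {
  ntob :> forall X, F X -> G X;
  ntB : forall X, zmod_morphism (@ntob X);
  ntN : forall X Y (f : Hom V X Y) x, ntob (cmap f x) = cmap f (ntob x) }.

Section NatTransModule.
Variables (F G : cofun).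
Implicit Types s t : nattrans F G.

Lemma nattransP s t : (forall X x, s X x = t X x) -> s = t.
Proof.
case: s t => s sB sN [t tB tN] /= st.
have {}st : s = t by apply: functional_extensionality_dep => X; apply/funext/st.
case: _ / st tB tN => tB tN.
by rewrite (Prop_irrelevance sB tB) (Prop_irrelevance sN tN).
Qed.

Lemma ntD s X (x y : F X) : s X (x + y) = s X x + s X y.
Proof.
have s0 : s X 0 = 0 by rewrite -(subrr (0 : F X)) ntB subrr.
by rewrite -{1}(opprK y) -(sub0r y) ntB ntB s0 sub0r opprK.
Qed.

Lemma ntZ s X a (x : kval F X) : s X (a *: x) = a *: (s X x : kval G X).
Proof. exact: ntN. Qed.

Definition nzero : nattrans F G.
Proof.
apply: (@NatTrans F G (fun X x => 0)) => [X x y|X Y f x]; first by rewrite subrr.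
by rewrite cmap0.
Defined.

Definition nopp s : nattrans F G.
Proof.
apply: (@NatTrans F G (fun X x => - s X x)) => [X x y|X Y f x].
  by rewrite ntB opprD.
by rewrite -(sub0r (s Y x)) cmapB cmap0 sub0r ntN.
Defined.

Definition nadd s t : nattrans F G.
Proof.
apply: (@NatTrans F G (fun X x => s X x + t X x)) => [X x y|X Y f x].
  by rewrite !ntB opprD addrACA.
by rewrite !ntN cmapD.
Defined.

Definition nscale (a : k) s : nattrans F G.
Proof.
apply: (@NatTrans F G (fun X x => a *: (s X x : kval G X))) => [X x y|X Y f x].
  by rewrite ntB scalerBr.
by rewrite cmapZ ntN.
Defined.

HB.instance Definition _ := gen_eqMixin (nattrans F G).
HB.instance Definition _ := gen_choiceMixin (nattrans F G).

Fact naddA : associative nadd.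
Proof. by move=> s t u; apply: nattransP => X x /=; rewrite addrA. Qed.
Fact naddC : commutative nadd.
Proof. by move=> s t; apply: nattransP => X x /=; rewrite addrC. Qed.
Fact nadd0 : left_id nzero nadd.
Proof. by move=> s; apply: nattransP => X x /=; rewrite add0r. Qed.
Fact naddN : left_inverse nzero nopp nadd.
Proof. by move=> s; apply: nattransP => X x /=; rewrite addNr. Qed.

HB.instance Definition _ :=
  GRing.isZmodule.Build (nattrans F G) naddA naddC nadd0 naddN.

Fact nscaleA a b s : nscale a (nscale b s) = nscale (a * b) s.
Proof. by apply: nattransP => X x /=; rewrite -scalerA. Qed.
Fact nscale1 : left_id 1 nscale.
Proof. by move=> s; apply: nattransP => X x /=; rewrite scale1r. Qed.
Fact nscaleDr : right_distributive nscale +%R.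
Proof. by move=> a s t; apply: nattransP => X x /=; rewrite scalerDr. Qed.
Fact nscaleDl s : {morph nscale^~ s : a b / a + b}.
Proof. by move=> a b; apply: nattransP => X x /=; rewrite scalerDl. Qed.

HB.instance Definition _ :=
  GRing.Zmodule_isLmodule.Build k (nattrans F G)
    nscaleA nscale1 nscaleDr nscaleDl.

End NatTransModule.

Definition nid (F : cofun) : nattrans F F :=
  @NatTrans F F (fun X x => x) (fun X x y => erefl) (fun X Y f x => erefl).

Definition ncomp (F G H : cofun) (t : nattrans G H) (s : nattrans F G) :
  nattrans F H.
Proof.
apply: (@NatTrans F H (fun X x => t X (s X x))) => [X x y|X Y f x].
  by rewrite !ntB.
by rewrite !ntN.
Defined.

Definition Mod : lincat k cofun.
Proof.
apply: (@LinCat k cofun nattrans nid ncomp).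
- by move=> F G H t a s u; apply: nattransP => X x /=; rewrite ntD ntZ.
- by move=> F G H s a t u; apply: nattransP.
- by move=> F G s; apply: nattransP.
- by move=> F G s; apply: nattransP.
- by move=> F G H K u t s; apply: nattransP.
Defined.

Definition hom_functor (X : T) : cofun.
Proof.
apply: (@Cofun (fun Y => Hom V Y X) (fun Y Z f g => g ∘ f)).
- move=> Y Z f g h /=; rewrite compDl; congr (_ + _).
  by rewrite -scaleN1r compZl scaleN1r.
- move=> Y Z f g h /=; rewrite compDr; congr (_ + _).
  by rewrite -scaleN1r compZr scaleN1r.
- by move=> Y f; rewrite compm1.
- by move=> Y Z W g f h; rewrite compA.
Defined.

Definition finitely_presented (F : cofun) : Prop :=
  exists (X Y : T) (s : nattrans (hom_functor X) (hom_functor Y))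
         (t : nattrans (hom_functor Y) F),
    (forall Z (x : F Z), exists y, t Z y = x) /\
    (forall Z y, t Z y = 0 <-> exists x, s Z x = y).

Definition fpmod : lincat k {F : cofun | finitely_presented F} :=
  full Mod finitely_presented.

End AdditiveFunctors.

Section DualFunctor.
Variables (k : fieldType) (T : Type) (V : lincat k T).

Definition dual_cofun_map (F : cofun V) X Y (f : Hom (op V) X Y) :
  dual (kval F Y) -> dual (kval F X).
Proof.
move=> phi; exists (fun x : kval F X => phi (cmap (f : Hom V Y X) x)) => a x y.
by rewrite cmapD cmapZ (dfunP phi).
Defined.

Definition dual_cofun (F : cofun V) : cofun (op V).
Proof.
apply: (@Cofun k T (op V) (fun X => dual (kval F X)) (@dual_cofun_map F)).
- by move=> X Y f x y; apply: dualP.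
- by move=> X Y f g phi; apply: dualP => x /=; rewrite cmapBf dualB.
- by move=> X phi; apply: dualP => x /=; rewrite cmap1.
- by move=> X Y Z g f phi; apply: dualP => x /=; rewrite cmapM.
Defined.

Definition dual_nattrans (F G : cofun V) (s : nattrans F G) :
  nattrans (dual_cofun G) (dual_cofun F).
Proof.
unshelve eapply NatTrans.
- move=> X phi; exists (fun x : kval F X => phi (s X x)) => a x y.
  by rewrite ntD ntZ (dfunP phi).
- by move=> X phi psi; apply: dualP.
- by move=> X Y f phi; apply: dualP => x /=; rewrite ntN.
Defined.

Definition dual_functor : lfunctor (Mod V) (op (Mod (op V))).
Proof.
apply: (@LFunctor k _ _ (Mod V) (op (Mod (op V))) dual_cofun dual_nattrans).
- move=> F G a s t; apply: nattransP => X phi; apply: dualP => x /=.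
  rewrite (dfunP phi); congr (_ + _).
  by rewrite (ntN (s : nattrans F G)); apply/esym/(dualZ phi).
- by move=> F; apply: nattransP => X phi; apply: dualP.
- by move=> F G H t s; apply: nattransP => X phi; apply: dualP.
Defined.

Definition induces_duality : Prop :=
  restricts_to_equivalence dual_functor
    (@finitely_presented k T V) (@finitely_presented k T (op V)).

End DualFunctor.

(* [op (op V)] is [V] up to the proof components. *)
Definition dualizing_variety (k : fieldType) (T : Type) (V : lincat k T) : Prop :=
  [/\ hom_finite V, krull_schmidt V, induces_duality V
    & induces_duality (op V)].

Record excat (k : fieldType) (T : Type) := ExCat {
  ecat :> lincat k T;
  conflation : forall X Y Z, Hom ecat X Y -> Hom ecat Y Z -> Prop }.

Arguments conflation {k T} _ {X Y Z} _ _.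

Definition kercoker_excat (k : fieldType) (T : Type) (C : lincat k T) :
    excat k T :=
  ExCat (fun X Y Z (i : Hom C X Y) (p : Hom C Y Z) => kercoker i p).

Definition full_excat (k : fieldType) (T : Type) (E : excat k T)
    (P : T -> Prop) : excat k {X : T | P X} :=
  @ExCat k _ (full E P) (fun X Y Z i p => @conflation k T E _ _ _ i p).

Definition exact_subcategory (k : fieldType) (T : Type) (E : excat k T)
    (P : T -> Prop) : Prop :=
  (exists X, P X /\ is_zero E X) /\
  forall X Y Z (i : Hom E X Y) (p : Hom E Y Z),
    conflation E i p -> P X -> P Z -> P Y.

Section Exact.
Variables (k : fieldType) (T : Type) (E : excat k T).
Implicit Types X Y Z : T.

Definition inflation X Y (i : Hom E X Y) : Prop :=
  exists Z (p : Hom E Y Z), conflation E i p.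

Definition deflation Y Z (p : Hom E Y Z) : Prop :=
  exists X (i : Hom E X Y), conflation E i p.

Record quillen_exact : Prop := QuillenExact {
  qe_additive : additive_cat E;
  qe_kercoker : forall X Y Z (i : Hom E X Y) (p : Hom E Y Z),
    conflation E i p -> kercoker i p;
  qe_iso : forall X Y Z X' Y' Z' (i : Hom E X Y) (p : Hom E Y Z)
      (i' : Hom E X' Y') (p' : Hom E Y' Z')
      (a : Hom E X X') (b : Hom E Y Y') (c : Hom E Z Z'),
    is_iso a -> is_iso b -> is_iso c -> b ∘ i = i' ∘ a -> c ∘ p = p' ∘ b ->
    conflation E i p -> conflation E i' p';
  qe_inf1 : forall X, inflation (idm E X);
  qe_def1 : forall X, deflation (idm E X);
  qe_infM : forall X Y Z (j : Hom E Y Z) (i : Hom E X Y),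
    inflation j -> inflation i -> inflation (j ∘ i);
  qe_defM : forall X Y Z (q : Hom E Y Z) (p : Hom E X Y),
    deflation q -> deflation p -> deflation (q ∘ p);
  qe_pushout : forall X Y X' (i : Hom E X Y) (f : Hom E X X'), inflation i ->
    exists Y' (g : Hom E Y Y') (j : Hom E X' Y'),
      is_pushout i f g j /\ inflation j;
  qe_pullback : forall Y Y' X' (g : Hom E X' Y') (p : Hom E Y Y'), deflation p ->
    exists X (q : Hom E X X') (f : Hom E X Y),
      is_pullback f q p g /\ deflation q }.

(* The elements of [Ext^1(Z, X)] are the classes of these extensions. *)
Record ext Z X := Ext {
  emid : T;
  einf : Hom E X emid;
  edef : Hom E emid Z;
  econf : conflation E einf edef }.

Definition ext_map Z X Z' X' (a : Hom E X X') (c : Hom E Z Z')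
    (e : ext Z X) (e' : ext Z' X') : Prop :=
  exists b : Hom E (emid e) (emid e'),
    b ∘ einf e = einf e' ∘ a /\ edef e' ∘ b = c ∘ edef e.

Definition ext_equiv Z X (e e' : ext Z X) : Prop :=
  ext_map (idm E X) (idm E Z) e e'.

(* [e'] represents the push-forward of [e] along [a]. *)
Definition ext_push Z X X' (a : Hom E X X') (e : ext Z X) (e' : ext Z X') : Prop :=
  ext_map a (idm E Z) e e'.

(* [e'] represents the pull-back of [e] along [c]. *)
Definition ext_pull Z Z' X (c : Hom E Z' Z) (e : ext Z X) (e' : ext Z' X) : Prop :=
  ext_map (idm E X) c e' e.

(* [e] represents the Baer sum of [e1] and [e2]: push out the direct sum of
   [e1] and [e2] along the codiagonal and pull back along the diagonal. *)
Definition baer_sum Z X (e1 e2 e : ext Z X) : Prop :=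
  exists (XX : biprod E X X) (ZZ : biprod E Z Z)
         (MM : biprod E (emid e1) (emid e2))
         (c : conflation E
            (bin1 MM ∘ einf e1 ∘ bpr1 XX + bin2 MM ∘ einf e2 ∘ bpr2 XX)
            (bin1 ZZ ∘ edef e1 ∘ bpr1 MM + bin2 ZZ ∘ edef e2 ∘ bpr2 MM))
         (e' : ext (bsum ZZ) X),
    ext_push (bpr1 XX + bpr2 XX) (Ext c) e' /\
    ext_pull (bin1 ZZ + bin2 ZZ) e' e.

(* The class of [e] is zero in [Ext^1(Z, X)]. *)
Definition ext_split Z X (e : ext Z X) : Prop :=
  exists (r : Hom E (emid e) X) (s : Hom E Z (emid e)),
    [/\ r ∘ einf e = idm E X, edef e ∘ s = idm E Z
      & einf e ∘ r + s ∘ edef e = idm E (emid e)].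

Definition ext_projective X : Prop := forall Y (e : ext X Y), ext_split e.

Definition ext_injective X : Prop := forall Z (e : ext Z X), ext_split e.

Definition enough_projectives : Prop :=
  forall X, exists P (p : Hom E P X), ext_projective P /\ deflation p.

Definition enough_injectives : Prop :=
  forall X, exists I (i : Hom E X I), ext_injective I /\ inflation i.

Definition frobenius : Prop :=
  [/\ quillen_exact, enough_projectives, enough_injectives
    & forall X, ext_projective X <-> ext_injective X].

(* The elements of [D Ext^1(Z, X)], as functions on extensions. *)
Definition ext_form Z X (phi : ext Z X -> k) : Prop :=
  [/\ forall e e', ext_equiv e e' -> phi e = phi e',
      forall e1 e2 e, baer_sum e1 e2 e -> phi e = phi e1 + phi e2
    & forall a e e', ext_push (a *: idm E X) e e' -> phi e' = a * phi e].

End Exact.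

Section Stable.
Variables (k : fieldType) (T : Type) (E : excat k T).

Section StableHom.
Variables X Y : T.

(* The ideal generated by the morphisms that factor through an Ext-injective;
   when finite direct sums exist one summand is enough.  In a Frobenius category
   this is also the ideal of the Ext-projectives, so that [stab] below is both
   the injectively and the projectively stable category. *)
Inductive null : Hom E X Y -> Prop :=
| null_zero : null 0
| null_add (f : Hom E X Y) I (h : Hom E I Y) (g : Hom E X I) :
    null f -> ext_injective E I -> null (f + h ∘ g).

Lemma null_lin a f g : null f -> null g -> null (a *: f + g).
Proof.
move=> nf ng; elim: nf => [|{}f I h u _ IH injI]; first by rewrite scaler0 add0r.
by rewrite scalerDr addrAC -compZl; apply: null_add.
Qed.

Definition nullb (f : Hom E X Y) : bool := `[< null f >].

Fact nullb_closed : zmod_closed nullb.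
Proof.
split=> [|f g /asboolP nf /asboolP ng]; apply/asboolP; first exact: null_zero.
by rewrite addrC -scaleN1r; apply: null_lin.
Qed.

HB.instance Definition _ := GRing.isZmodClosed.Build (Hom E X Y) nullb nullb_closed.

Definition null_ideal : zmodClosed (Hom E X Y) :=
  GRing.ZmodClosed.clone (Hom E X Y) nullb _.

Definition stabHom : Type := Quotient.quot null_ideal.

HB.instance Definition _ := GRing.Zmodule.on stabHom.

Definition stabpi (f : Hom E X Y) : stabHom := \pi_(Quotient.quot null_ideal) f.

Lemma stabpi_eq f g : stabpi f = stabpi g <-> null (f - g).
Proof.
split=> [/eqP|nfg]; first by rewrite -Quotient.idealrBE => /asboolP.
by apply/eqP; rewrite -Quotient.idealrBE; apply/asboolP.
Qed.

Lemma stabpi_surj (q : stabHom) : exists f, q = stabpi f.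
Proof. by exists (repr q); rewrite /stabpi reprK. Qed.

Lemma stabpiD f g : stabpi (f + g) = stabpi f + stabpi g.
Proof. by rewrite /stabpi raddfD. Qed.

Lemma null_repr f : null (repr (stabpi f) - f).
Proof. by apply/stabpi_eq; rewrite /stabpi reprK. Qed.

Definition stabscale (a : k) (q : stabHom) : stabHom := stabpi (a *: repr q).

Lemma stabscaleE a f : stabscale a (stabpi f) = stabpi (a *: f).
Proof.
apply/stabpi_eq; rewrite -scalerBr -[_ *: _]addr0.
by apply: null_lin (null_repr f) null_zero.
Qed.

Fact stabscaleA a b q : stabscale a (stabscale b q) = stabscale (a * b) q.
Proof. by have [f ->] := stabpi_surj q; rewrite !stabscaleE scalerA. Qed.
Fact stabscale1 : left_id 1 stabscale.
Proof. by move=> q; have [f ->] := stabpi_surj q; rewrite stabscaleE scale1r. Qed.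
Fact stabscaleDr : right_distributive stabscale +%R.
Proof.
move=> a q r; have [f ->] := stabpi_surj q; have [g ->] := stabpi_surj r.
by rewrite -stabpiD !stabscaleE scalerDr stabpiD.
Qed.
Fact stabscaleDl q : {morph stabscale^~ q : a b / a + b}.
Proof.
by move=> a b; have [f ->] := stabpi_surj q; rewrite !stabscaleE scalerDl stabpiD.
Qed.

HB.instance Definition _ :=
  GRing.Zmodule_isLmodule.Build k stabHom
    stabscaleA stabscale1 stabscaleDr stabscaleDl.

Lemma stabpiZ a f : stabpi (a *: f) = a *: stabpi f.
Proof. by rewrite -stabscaleE. Qed.

End StableHom.

Lemma null_compl X Y Z (g : Hom E Y Z) (f : Hom E X Y) : null f -> null (g ∘ f).
Proof.
elim=> [|{}f I h u _ IH injI]; first by rewrite compm0; apply: null_zero.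
by rewrite compDr compA; apply: null_add.
Qed.

Lemma null_compr X Y Z (g : Hom E Y Z) (f : Hom E X Y) : null g -> null (g ∘ f).
Proof.
elim=> [|{}g I h u _ IH injI]; first by rewrite comp0m; apply: null_zero.
by rewrite compDl -compA; apply: null_add.
Qed.

Definition stabcomp X Y Z (g : stabHom Y Z) (f : stabHom X Y) : stabHom X Z :=
  stabpi (repr g ∘ repr f).

Lemma stabcompE X Y Z (g : Hom E Y Z) (f : Hom E X Y) :
  stabcomp (stabpi g) (stabpi f) = stabpi (g ∘ f).
Proof.
apply/stabpi_eq.
have -> : repr (stabpi g) ∘ repr (stabpi f) - g ∘ f =
    1 *: ((repr (stabpi g) - g) ∘ repr (stabpi f)) + g ∘ (repr (stabpi f) - f).
  rewrite scale1r compDl compDr -!scaleN1r compZl compZr !scaleN1r.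
  by rewrite addrA addrNK.
by apply: null_lin; [apply: null_compr | apply: null_compl]; apply: null_repr.
Qed.

Definition stab : lincat k T.
Proof.
apply: (@LinCat k T stabHom (fun X => stabpi (idm E X)) stabcomp).
- move=> X Y Z g a f1 f2; have [g' ->] := stabpi_surj g.
  have [f1' ->] := stabpi_surj f1; have [f2' ->] := stabpi_surj f2.
  by rewrite -stabpiZ -stabpiD !stabcompE compDr compZr stabpiD stabpiZ.
- move=> X Y Z f a g1 g2; have [f' ->] := stabpi_surj f.
  have [g1' ->] := stabpi_surj g1; have [g2' ->] := stabpi_surj g2.
  by rewrite -stabpiZ -stabpiD !stabcompE compDl compZl stabpiD stabpiZ.
- by move=> X Y f; have [f' ->] := stabpi_surj f; rewrite stabcompE comp1m.
- by move=> X Y f; have [f' ->] := stabpi_surj f; rewrite stabcompE compm1.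
- move=> X Y Z W h g f; have [f' ->] := stabpi_surj f.
  have [g' ->] := stabpi_surj g; have [h' ->] := stabpi_surj h.
  by rewrite !stabcompE compA.
Defined.

(* The suspension of the stable category: [susp X] is the end of a conflation
   from [X] through an Ext-injective, [susp] acts on the class of a morphism [f]
   by completing [f] to morphisms of conflations.  The suspension depends on the
   chosen conflations only up to natural isomorphism; [desusp] is a
   quasi-inverse. *)
Record suspension := Suspension {
  susp : lfunctor stab stab;
  shull : T -> T;
  shull_injective : forall X, ext_injective E (shull X);
  sinf : forall X, Hom E X (shull X);
  sdef : forall X, Hom E (shull X) (susp X);
  sconf : forall X, conflation E (sinf X) (sdef X);
  suspE : forall X Y (f : Hom E X Y) (g : Hom E (shull X) (shull Y))
      (h : Hom E (susp X) (susp Y)),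
    g ∘ sinf X = sinf Y ∘ f -> h ∘ sdef X = sdef Y ∘ g ->
    fhom susp (stabpi f : Hom stab X Y) = stabpi h;
  desusp : lfunctor stab stab;
  suspK : naturally_isomorphic (fcomp desusp susp) (fid stab);
  desuspK : naturally_isomorphic (fcomp susp desusp) (fid stab) }.

Definition shift (S : suspension) (n : int) : lfunctor stab stab :=
  match n with
  | Posz m => fiter m (susp S)
  | Negz m => fiter m.+1 (desusp S)
  end.

End Stable.

Definition serre_duality (k : fieldType) (T : Type) (C : lincat k T)
    (Sh : lfunctor C C) : Prop :=
  exists Phi : forall A B, Hom C A B -> dual (Hom C B (Sh A)),
    [/\ forall A B, linear (@Phi A B),
        forall A B, bijective (@Phi A B)
      & forall A B A' B' (u : Hom C A' A) (v : Hom C B B') (f : Hom C A B)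
          (x : Hom C B' (Sh A')),
          Phi A' B' (v ∘ f ∘ u) x = Phi A B f (fhom Sh u ∘ x ∘ v)].

Definition stably_calabi_yau (k : fieldType) (T : Type) (E : excat k T)
    (d : int) : Prop :=
  hom_finite E /\ frobenius E /\
  exists S : suspension E, serre_duality (shift S d).

(* Binatural isomorphisms [Hom(f, g) = D Ext^1(g, tau f)] with [Hom] taken in
   the stable category.  In the last clause [e] represents the image of the
   class of [e'] under [Ext^1(v, tau u)]; the action of the stable morphisms
   [v] and [tau u] on [Ext^1] is through arbitrary representatives. *)
Definition auslander_reiten_duality (k : fieldType) (T : Type) (E : excat k T)
    (tau : lfunctor (stab E) (stab E)) : Prop :=
  exists Phi : forall f g, Hom (stab E) f g -> ext E g (tau f) -> k,
    [/\ forall f g a (x y : Hom (stab E) f g) e,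
          Phi f g (a *: x + y) e = a * Phi f g x e + Phi f g y e,
        forall f g (x : Hom (stab E) f g), ext_form (Phi f g x),
        forall f g (phi : ext E g (tau f) -> k), ext_form phi ->
          exists! x : Hom (stab E) f g, forall e, Phi f g x e = phi e
      & forall f g f' g' (u : Hom (stab E) f' f) (v : Hom E g g')
          (t : Hom E (tau f') (tau f)) (x : Hom (stab E) f g)
          (e' : ext E g' (tau f')) (e'' : ext E g (tau f')) (e : ext E g (tau f)),
          stabpi t = fhom tau u -> ext_pull v e' e'' -> ext_push t e'' e ->
          Phi f' g' ((stabpi v : Hom (stab E) g g') ∘ x ∘ u) e' = Phi f g x e].

Definition auslander_reiten_translation (k : fieldType) (T : Type)
    (E : excat k T) (tau : lfunctor (stab E) (stab E)) : Prop :=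
  is_equivalence tau /\ auslander_reiten_duality tau.

Section Monomorphism.
Variables (k : fieldType) (T : Type) (E : excat k T).

Record mono := Mono {
  msrc : T;
  mtgt : T;
  marr : Hom E msrc mtgt;
  marrP : inflation marr }.

Section MonoHom.
Variables f g : mono.

Definition commsq : pred (Hom E (msrc f) (msrc g) * Hom E (mtgt f) (mtgt g)) :=
  fun ab => ab.2 ∘ marr f == marr g ∘ ab.1.

Fact commsq_closed : submod_closed commsq.
Proof.
split=> [|a [u1 u2] [v1 v2] /eqP /= hu /eqP /= hv]; apply/eqP => /=.
  by rewrite comp0m compm0.
by rewrite compDl compZl hu hv compDr compZr.
Qed.

HB.instance Definition _ := GRing.isSubmodClosed.Build k
  (Hom E (msrc f) (msrc g) * Hom E (mtgt f) (mtgt g))%type commsq commsq_closed.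

Record monoHom := MonoHom {
  monoval :> Hom E (msrc f) (msrc g) * Hom E (mtgt f) (mtgt g);
  monovalP : monoval \in commsq }.

HB.instance Definition _ := [isSub for monoval].
HB.instance Definition _ := [Choice of monoHom by <:].
HB.instance Definition _ := [SubChoice_isSubLmodule of monoHom by <:].

End MonoHom.

Definition mono_id f : monoHom f f.
Proof. by exists (idm E _, idm E _); apply/eqP; rewrite /= comp1m compm1. Defined.

Definition mono_comp f g h (b : monoHom g h) (a : monoHom f g) : monoHom f h.
Proof.
exists (b.1 ∘ a.1, b.2 ∘ a.2); apply/eqP => /=.
by rewrite -compA (eqP (monovalP a)) compA (eqP (monovalP b)) compA.
Defined.

Definition mono_lincat : lincat k mono.
Proof.
apply: (@LinCat k mono monoHom mono_id mono_comp).
- by move=> f g h b c a a'; apply: val_inj; rewrite /= !compDr !compZr.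
- by move=> f g h a c b b'; apply: val_inj; rewrite /= !compDl !compZl.
- by move=> f g [[a b] p]; apply: val_inj; rewrite /= !comp1m.
- by move=> f g [[a b] p]; apply: val_inj; rewrite /= !compm1.
- by move=> f g h l c b a; apply: val_inj; rewrite /= !compA.
Defined.

Definition monocat : excat k mono :=
  @ExCat k mono mono_lincat (fun f g h (i : monoHom f g) (p : monoHom g h) =>
    conflation E i.1 p.1 /\ conflation E i.2 p.2).

End Monomorphism.

(* Main.v *)
Require Import Defs.
From HB Require Import structures.
From mathcomp Require Import all_boot all_algebra.
From mathcomp Require Import boolp.
Import Defs.

(** Let [f : X -> Y] be an inflation with cokernel [p : Y -> Z], completed to a
    triangle [X -> Y -> Z -> X[1]] of the stable category of [C].

    An object of the stable monomorphism category is determined up to isomorphism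
    by its class in the morphism category of the stable category of [C]
    ([arr_iso_iso]): every commutative square of stable morphisms lifts, and the
    squares that become trivial form an ideal of square zero. Consequently the
    rotation of [f], a monomorphism with the same stable class as [p], is well
    defined up to isomorphism ([rotate_iso]). Turning a triangle three times gives
    [-f[1]], which is isomorphic to [f[1]] as an object, so the cube of the rotation
    is the suspension ([rotate_cube]); in particular the rotation commutes with the
    suspension.

    Auslander-Reiten duality says that [h], the suspension of [tau f], is dual to
    [f]: the spaces [Hom(f, g)] and [Hom(g, h)] are in perfect natural duality. Take
    for [g] the identity of an object [W], and then the object with source zero and
    target [W]. By adjunction [Hom(f, g)] is [Hom(Y, W)] in the first case and
    [Hom(Z, W)] in the second, whereas [Hom(g, h)] is [Hom(W, msrc h)] and
    [Hom(W, mtgt h)]. So the source and the target of [h] are Serre dual to [Y] and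
    [Z] in the stable category of [C], compatibly with [p] ([serre_object_trace]).
    By the Calabi-Yau property and the uniqueness of Serre objects, [h] has the class
    of [p[d]] ([serre_arr_iso]), so the suspension of [tau f] is the rotation of [f]
    shifted by [d] ([susp_tau]).

    Hence [tau] is the rotation shifted by [d - 1], and its sixth power is the double
    suspension shifted by [6 (d - 1)], which is the shift by [6 d - 4].

    Dualities are handled through one linear form each, the trace: the form that a
    natural duality assigns to an identity morphism. Finite dimension of the
    morphism spaces enters only where a form is represented by a morphism
    ([serre_morphism]). *)

Set Implicit Arguments.
Unset Strict Implicit.
Unset Printing Implicit Defensive.

Import GRing.Theory.
Local Open Scope ring_scope.

(** * Linear forms and isomorphisms *)

Section LinearAlgebra.
Variables (k : fieldType) (U : lmodType k).

Lemma dualD (f : dual U) x y : f (x + y) = f x + f y.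
Proof. by rewrite -[x]scale1r (dfunP f) mul1r scale1r. Qed.

Lemma dual0 (f : dual U) : f 0 = 0.
Proof. by rewrite -(subrr 0) dualB subrr. Qed.

(** Applied to the forms [u |-> t (b j ∘ u)] for a spanning
    family [b], it turns a nondegenerate pairing into a surjection onto the dual,
    without choosing a basis. *)
Lemma dual_span n (phi : 'I_n -> dual U) (psi : dual U) :
  (forall u, (forall j, phi j u = 0) -> psi u = 0) ->
  exists c : 'I_n -> k, forall u, psi u = \sum_j c j * phi j u.
Proof.
elim: n phi psi => [|n IH] phi psi ker_phi.
  by exists (fun=> 0) => u; rewrite big_ord0; apply: ker_phi; case.
pose phi' j := phi (lift ord_max j); pose l := phi ord_max.
have split_phi u : (forall j, phi' j u = 0) -> l u = 0 -> psi u = 0.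
  move=> u0 lu; apply: ker_phi => j.
  by case: (unliftP ord_max j) => [j'|] ->; [apply: u0 | apply: lu].
(* Either the last form takes a nonzero value on the common kernel of the others,
   and [psi] is corrected by a multiple of it, or it is redundant. *)
have [[u0 [u0P lu0]]|no_u] :=
  pselect (exists u, (forall j, phi' j u = 0) /\ l u <> 0).
- pose a := psi u0 / l u0.
  have [|c cE] := IH phi' (psi - a *: l).
    move=> u uP /=.
    have lu0' : l u0 != 0 by apply/eqP.
    have /split_phi : forall j, phi' j (u - (l u / l u0) *: u0) = 0.
      by move=> j; rewrite dualB dualZ uP u0P mulr0 subr0.
    rewrite !dualB !dualZ divfK // subrr => /(_ erefl) /eqP.
    by move/eqP => <-; congr (_ - _); rewrite /a mulrAC [RHS]mulrAC [psi u0 * _]mulrC.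
  exists (fun j => if unlift ord_max j is Some j' then c j' else a) => u.
  rewrite big_ord_recr /= unlift_none -/l -(subrK (a * l u) (psi u)).
  congr (_ + _); rewrite -[LHS]/((psi - a *: l) u) cE; apply: eq_bigr => j _.
  have -> : widen_ord (leqnSn n) j = lift ord_max j.
    by apply: val_inj; rewrite /= /bump leqNgt ltn_ord.
  by rewrite liftK.
- have [|c cE] := IH phi' psi.
    move=> u uP; apply: split_phi (uP) _.
    by have [//|lu] := eqVneq (l u) 0; case: no_u; exists u; split=> //; apply/eqP.
  exists (fun j => if unlift ord_max j is Some j' then c j' else 0) => u.
  rewrite big_ord_recr /= unlift_none mul0r addr0 cE; apply: eq_bigr => j _.
  have -> : widen_ord (leqnSn n) j = lift ord_max j.
    by apply: val_inj; rewrite /= /bump leqNgt ltn_ord.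
  by rewrite liftK.
Qed.

End LinearAlgebra.

Section CompositionOpposite.
Variables (k : fieldType) (T : Type) (C : lincat k T).

Lemma compNl (X Y Z : T) (f : Hom C X Y) (g : Hom C Y Z) : (- g) ∘ f = - (g ∘ f).
Proof. by rewrite -scaleN1r compZl scaleN1r. Qed.

Lemma compNr (X Y Z : T) (f : Hom C X Y) (g : Hom C Y Z) : g ∘ (- f) = - (g ∘ f).
Proof. by rewrite -scaleN1r compZr scaleN1r. Qed.

Lemma compBl (X Y Z : T) (f : Hom C X Y) (g h : Hom C Y Z) :
  (g - h) ∘ f = g ∘ f - h ∘ f.
Proof. by rewrite compDl compNl. Qed.

Lemma compBr (X Y Z : T) (f h : Hom C X Y) (g : Hom C Y Z) :
  g ∘ (f - h) = g ∘ f - g ∘ h.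
Proof. by rewrite compDr compNr. Qed.

End CompositionOpposite.

Section Isomorphisms.
Variables (k : fieldType) (T : Type) (C : lincat k T).

Lemma is_iso_id X : is_iso (idm C X).
Proof. by exists (idm C X); split; rewrite comp1m. Qed.

Lemma is_iso_comp X Y Z (g : Hom C Y Z) (f : Hom C X Y) :
  is_iso g -> is_iso f -> is_iso (g ∘ f).
Proof.
move=> [g' [g'g gg']] [f' [f'f ff']]; exists (f' ∘ g'); split.
  by rewrite -compA [g' ∘ _]compA g'g comp1m.
by rewrite -compA [f ∘ _]compA ff' comp1m.
Qed.

Lemma is_iso_inv X Y (f : Hom C X Y) (g : Hom C Y X) :
  is_inverse f g -> is_iso g.
Proof. by move=> [gf fg]; exists f. Qed.

Lemma is_isoN X Y (f : Hom C X Y) : is_iso f -> is_iso (- f).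
Proof.
move=> [g [gf fg]]; exists (- g).
by split; rewrite compNl compNr opprK.
Qed.

Lemma iso_refl X : isomorphic C X X.
Proof. by exists (idm C X); apply: is_iso_id. Qed.

Lemma iso_sym X Y : isomorphic C X Y -> isomorphic C Y X.
Proof. by move=> [f [g fg]]; exists g; apply: is_iso_inv fg. Qed.

Lemma iso_trans Y X Z : isomorphic C X Y -> isomorphic C Y Z -> isomorphic C X Z.
Proof. by move=> [f fP] [g gP]; exists (g ∘ f); apply: is_iso_comp. Qed.

Lemma is_iso_lr X Y (f : Hom C X Y) (g h : Hom C Y X) :
  is_iso (g ∘ f) -> is_iso (f ∘ h) -> is_iso f.
Proof.
move=> [u [ugf _]] [v [_ fhv]]; exists (u ∘ g); split; first by rewrite -compA.
have -> : u ∘ g = h ∘ v.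
  by rewrite -[LHS]compm1 -fhv -[f ∘ h ∘ v]compA compA -[u ∘ g ∘ f]compA ugf comp1m.
by rewrite compA.
Qed.

(** Isomorphism in the morphism category. Monomorphisms are compared through this
    relation on their classes in the stable category. *)
Definition arr_iso X Y X' Y' (f : Hom C X Y) (f' : Hom C X' Y') : Prop :=
  exists (a : Hom C X X') (b : Hom C Y Y'), [/\ is_iso a, is_iso b & b ∘ f = f' ∘ a].

Lemma arr_iso_refl X Y (f : Hom C X Y) : arr_iso f f.
Proof.
by exists (idm C X), (idm C Y); split; rewrite ?comp1m ?compm1 //; apply: is_iso_id.
Qed.

Lemma arr_iso_sym X Y X' Y' (f : Hom C X Y) (f' : Hom C X' Y') :
  arr_iso f f' -> arr_iso f' f.
Proof.
move=> [a [b [[a' aa'] [b' bb'] bf]]]; exists a', b'; split.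
- exact: is_iso_inv aa'.
- exact: is_iso_inv bb'.
case: aa' bb' => _ aa' [b'b _].
by rewrite -[LHS]compm1 -aa' compA -[b' ∘ f' ∘ a]compA -bf [b' ∘ _]compA b'b comp1m.
Qed.

Lemma arr_iso_trans X' Y' (f' : Hom C X' Y') X Y (f : Hom C X Y)
    X'' Y'' (f'' : Hom C X'' Y'') :
  arr_iso f f' -> arr_iso f' f'' -> arr_iso f f''.
Proof.
move=> [a [b [aP bP bf]]] [c [e [cP eP ef]]]; exists (c ∘ a), (e ∘ b).
by split; [apply: is_iso_comp| apply: is_iso_comp|]; rewrite // -compA bf !compA ef.
Qed.

End Isomorphisms.

Section FunctorIso.
Variables (k : fieldType) (T U : Type) (C : lincat k T) (D : lincat k U).
Variable F : lfunctor C D.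

Lemma fhom_is_iso X Y (f : Hom C X Y) : is_iso f -> is_iso (fhom F f).
Proof. by move=> [g [gf fg]]; exists (fhom F g); split; rewrite -fhomM ?gf ?fg fhom1. Qed.

Lemma fob_iso X Y : isomorphic C X Y -> isomorphic D (F X) (F Y).
Proof. by move=> [f fP]; exists (fhom F f); apply: fhom_is_iso. Qed.

Lemma fhom_arr_iso X Y X' Y' (f : Hom C X Y) (f' : Hom C X' Y') :
  arr_iso f f' -> arr_iso (fhom F f) (fhom F f').
Proof.
move=> [a [b [aP bP bf]]]; exists (fhom F a), (fhom F b).
by split; [apply: fhom_is_iso|apply: fhom_is_iso|]; rewrite // -!fhomM bf.
Qed.

Lemma fhom0 X Y : fhom F (0 : Hom C X Y) = 0.
Proof. by have := fhom_lin F (-1) (0 : Hom C X Y) 0; rewrite !scaleN1r !addNr. Qed.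

Lemma natural_iso_ob (G : lfunctor C D) X :
  naturally_isomorphic F G -> isomorphic D (F X) (G X).
Proof. by move=> [e [eP _]]; exists (e X). Qed.

Lemma natural_arr_iso (G : lfunctor C D) X Y (f : Hom C X Y) :
  naturally_isomorphic F G -> arr_iso (fhom F f) (fhom G f).
Proof. by move=> [e [eP eN]]; exists (e X), (e Y). Qed.

End FunctorIso.

(** * Serre objects *)

Section SerreObjects.
Variables (k : fieldType) (T : Type) (C : lincat k T).

(** Such a form exhibits [A] as the value at [Y] of a Serre functor: between
    finite-dimensional spaces, nondegeneracy of [t (v ∘ u)] is a duality between
    [Hom C Y W] and [Hom C W A], and it is natural in [W] by construction.
    Conversely a natural duality is determined by the form that it assigns to the
    identity of [Y]. *)
Record serre_trace Y A (t : dual (Hom C Y A)) : Prop := SerreTrace {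
  serre_left : forall W (u : Hom C Y W),
    (forall v : Hom C W A, t (v ∘ u) = 0) -> u = 0;
  serre_right : forall W (v : Hom C W A),
    (forall u : Hom C Y W, t (v ∘ u) = 0) -> v = 0 }.

Hypothesis hom_fin : hom_finite C.

(** The pairing [t (phi ∘ u)] has no kernel on the side of [u], and [phi] ranges
    over a finite-dimensional space, so every form in [u] is represented. *)
Lemma serre_morphism Y A (s : dual (Hom C Y A)) A' (t : dual (Hom C Y A')) :
  serre_trace t -> exists phi : Hom C A A', forall u, t (phi ∘ u) = s u.
Proof.
move=> tP; have [n [b bP]] := hom_fin A A'.
have linj j : scalar (fun u : Hom C Y A => t (b j ∘ u)).
  by move=> a u v; rewrite compDr compZr (dfunP t).
have [|c cE] := @dual_span _ _ n (fun j => Dual (linj j)) s.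
  move=> u uP; rewrite (serre_left tP (u := u)) ?dual0 // => v.
  have [c ->] := bP v.
  have : forall (r : seq 'I_n), t ((\sum_(j <- r) c j *: b j) ∘ u) = 0.
    elim=> [|j r IH]; first by rewrite big_nil comp0m dual0.
    by have /= uj := uP j; rewrite big_cons compDl compZl (dfunP t) uj mulr0 add0r.
  by apply.
exists (\sum_j c j *: b j) => u; rewrite cE.
elim: (index_enum _) => [|j r IH]; first by rewrite !big_nil comp0m dual0.
by rewrite !big_cons compDl compZl (dfunP t) IH.
Qed.

(** The induced morphisms in both directions preserve the traces, so nondegeneracy
    forces their composites to be identities. *)
Lemma serre_morphism_iso Y A (s : dual (Hom C Y A)) A' (t : dual (Hom C Y A'))
    (phi : Hom C A A') :
  serre_trace s -> serre_trace t -> (forall u, t (phi ∘ u) = s u) -> is_iso phi.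
Proof.
move=> sP tP phiP; have [psi psiP] := serre_morphism t sP.
exists psi; split; apply/eqP; rewrite -subr_eq0; apply/eqP.
  apply: (serre_right sP) => u.
  by rewrite compBl comp1m dualB -compA psiP phiP subrr.
apply: (serre_right tP) => u.
by rewrite compBl comp1m dualB -compA phiP psiP subrr.
Qed.

(** A morphism between Serre objects that corresponds to [p] is determined by its
    adjunction formula with respect to the traces; hence the comparison of two
    choices of Serre objects is compatible with these morphisms. *)
Lemma serre_arr_iso Y Z (p : Hom C Y Z)
    A (s1 : dual (Hom C Y A)) B (s2 : dual (Hom C Z B)) (m : Hom C A B)
    A' (t1 : dual (Hom C Y A')) B' (t2 : dual (Hom C Z B')) (m' : Hom C A' B') :
  serre_trace s1 -> serre_trace s2 -> serre_trace t1 -> serre_trace t2 ->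
  (forall u, s2 (m ∘ u) = s1 (u ∘ p)) -> (forall u, t2 (m' ∘ u) = t1 (u ∘ p)) ->
  arr_iso m m'.
Proof.
move=> s1P s2P t1P t2P sm tm.
have [a aP] := serre_morphism s1 t1P; have [b bP] := serre_morphism s2 t2P.
exists a, b; split.
- exact: serre_morphism_iso aP.
- exact: serre_morphism_iso bP.
apply/eqP; rewrite -subr_eq0; apply/eqP; apply: (serre_right t2P) => u.
rewrite compBl dualB -!compA bP sm.
by rewrite tm -compA aP subrr.
Qed.

End SerreObjects.

(** * Stable categories *)

Section StableClass.
Variables (k : fieldType) (T : Type) (E : excat k T).

Definition st X Y (f : Hom E X Y) : Hom (stab E) X Y := stabpi f.

Lemma st_surj X Y (q : Hom (stab E) X Y) : exists f, q = st f.
Proof. exact: stabpi_surj. Qed.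

Lemma st_eq X Y (f g : Hom E X Y) : st f = st g <-> null (f - g).
Proof. exact: stabpi_eq. Qed.

Lemma stD X Y (f g : Hom E X Y) : st (f + g) = st f + st g.
Proof. exact: stabpiD. Qed.

Lemma stZ X Y a (f : Hom E X Y) : st (a *: f) = a *: st f.
Proof. exact: stabpiZ. Qed.

Lemma stN X Y (f : Hom E X Y) : st (- f) = - st f.
Proof. by rewrite -scaleN1r stZ scaleN1r. Qed.

Lemma stM X Y Z (g : Hom E Y Z) (f : Hom E X Y) : st (g ∘ f) = st g ∘ st f.
Proof. by rewrite /st /= stabcompE. Qed.

Lemma st1 X : st (idm E X) = idm (stab E) X.
Proof. by []. Qed.

Lemma st0 X Y : st (0 : Hom E X Y) = 0.
Proof. by rewrite -(scale0r 0) stZ scale0r. Qed.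

Lemma st_eq0 X Y (f : Hom E X Y) : st f = 0 <-> null f.
Proof. by rewrite -[in X in _ <-> X](subr0 f) -st0; apply: st_eq. Qed.

Lemma null_through X I Y (h : Hom E I Y) (g : Hom E X I) :
  ext_injective E I -> null (h ∘ g).
Proof. by move=> injI; rewrite -[_ ∘ _]add0r; apply/null_add => //; apply: null_zero. Qed.

End StableClass.

Section StableFunctor.
Variables (k : fieldType) (T U : Type) (E : excat k T) (E' : excat k U).
Variable F : lfunctor E E'.
Hypothesis F_inj : forall I, ext_injective E I -> ext_injective E' (F I).

Lemma fhom_null X Y (f : Hom E X Y) : null f -> null (fhom F f).
Proof.
elim=> [|{}f I h g _ IH injI]; first by rewrite fhom0; apply: null_zero.
have -> : fhom F (f + h ∘ g) = fhom F f + fhom F h ∘ fhom F g.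
  by have := fhom_lin F 1 f (h ∘ g); rewrite !scale1r fhomM.
by apply: null_add => //; apply: F_inj.
Qed.

Definition stab_fhom X Y (q : Hom (stab E) X Y) : Hom (stab E') (F X) (F Y) :=
  st (fhom F (projT1 (cid (st_surj q)))).

Lemma stab_fhomE X Y (f : Hom E X Y) : stab_fhom (st f) = st (fhom F f).
Proof.
rewrite /stab_fhom; case: cid => g /= /st_eq nfg; apply/esym/st_eq.
have -> : fhom F f - fhom F g = fhom F (f - g).
  by rewrite addrC -!scaleN1r -fhom_lin addrC.
exact: fhom_null.
Qed.

Fact stab_fhom_lin X Y : linear (@stab_fhom X Y).
Proof.
move=> a f g; have [f' ->] := st_surj f; have [g' ->] := st_surj g.
by rewrite -stZ -stD !stab_fhomE fhom_lin stD stZ.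
Qed.

Fact stab_fhom1 X : stab_fhom (idm (stab E) X) = idm (stab E') (F X).
Proof. by rewrite -st1 stab_fhomE fhom1. Qed.

Fact stab_fhomM X Y Z (g : Hom (stab E) Y Z) (f : Hom (stab E) X Y) :
  stab_fhom (g ∘ f) = stab_fhom g ∘ stab_fhom f.
Proof.
have [f' ->] := st_surj f; have [g' ->] := st_surj g.
by rewrite -stM !stab_fhomE fhomM stM.
Qed.

Definition stab_functor : lfunctor (stab E) (stab E') :=
  LFunctor stab_fhom_lin stab_fhom1 stab_fhomM.

Lemma stab_functorE X Y (f : Hom E X Y) : fhom stab_functor (st f) = st (fhom F f).
Proof. exact: stab_fhomE. Qed.

End StableFunctor.

(** * Exact categories and injective objects *)

Section KernelCokernel.
Variables (k : fieldType) (T : Type) (C : lincat k T).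

Lemma kernel_lift X Y Z (i : Hom C X Y) (p : Hom C Y Z) W (f : Hom C W Y) :
  is_kernel i p -> p ∘ f = 0 -> exists g, i ∘ g = f.
Proof. by move=> [_ ker] /ker [g []]; exists g. Qed.

Lemma cokernel_desc X Y Z (i : Hom C X Y) (p : Hom C Y Z) W (f : Hom C Y W) :
  is_cokernel i p -> f ∘ i = 0 -> exists g, g ∘ p = f.
Proof. by move=> [_ cok] /cok [g []]; exists g. Qed.

Lemma kernel_mono X Y Z (i : Hom C X Y) (p : Hom C Y Z) W (f g : Hom C W X) :
  is_kernel i p -> i ∘ f = i ∘ g -> f = g.
Proof.
move=> [pi ker] fg; have [|h [_ hu]] := ker _ (i ∘ f); first by rewrite compA pi comp0m.
by rewrite -(hu f) // -(hu g).
Qed.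

Lemma cokernel_epi X Y Z (i : Hom C X Y) (p : Hom C Y Z) W (f g : Hom C Z W) :
  is_cokernel i p -> f ∘ p = g ∘ p -> f = g.
Proof.
move=> [pi cok] fg; have [|h [_ hu]] := cok _ (f ∘ p); first by rewrite -compA pi compm0.
by rewrite -(hu f) // -(hu g).
Qed.

Lemma kernel_iso X X' Y Z (i : Hom C X Y) (i' : Hom C X' Y) (p : Hom C Y Z) :
  is_kernel i p -> is_kernel i' p -> exists a : Hom C X X', is_iso a /\ i' ∘ a = i.
Proof.
move=> ker ker'; have [a ia] := kernel_lift ker' (proj1 ker).
have [b ib] := kernel_lift ker (proj1 ker').
exists a; split=> //; exists b; split.
  by apply: (kernel_mono ker); rewrite compm1 compA ib.
by apply: (kernel_mono ker'); rewrite compm1 compA ia.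
Qed.

Lemma cokernel_iso X Y Z Z' (i : Hom C X Y) (p : Hom C Y Z) (p' : Hom C Y Z') :
  is_cokernel i p -> is_cokernel i p' -> exists a : Hom C Z Z', is_iso a /\ a ∘ p = p'.
Proof.
move=> cok cok'; have [a ia] := cokernel_desc cok (proj1 cok').
have [b ib] := cokernel_desc cok' (proj1 cok).
exists a; split=> //; exists b; split.
  by apply: (cokernel_epi cok); rewrite comp1m -compA ia.
by apply: (cokernel_epi cok'); rewrite comp1m -compA ib.
Qed.

Lemma pushout_joint_epi X Y X' Y' (i : Hom C X Y) (f : Hom C X X')
    (g : Hom C Y Y') (j : Hom C X' Y') W (u v : Hom C Y' W) :
  is_pushout i f g j -> u ∘ g = v ∘ g -> u ∘ j = v ∘ j -> u = v.
Proof.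
move=> [gi po] ug uj; have [|w [_ wu]] := po _ (u ∘ g) (u ∘ j).
  by rewrite -!compA gi.
by rewrite -(wu u) // -(wu v).
Qed.

Lemma pushout_desc X Y X' Y' (i : Hom C X Y) (f : Hom C X X')
    (g : Hom C Y Y') (j : Hom C X' Y') W (u : Hom C Y W) (v : Hom C X' W) :
  is_pushout i f g j -> u ∘ i = v ∘ f -> exists w, w ∘ g = u /\ w ∘ j = v.
Proof. by move=> [_ po] /po [w [[wg wj] _]]; exists w. Qed.

Lemma pushout_sym X Y X' Y' (i : Hom C X Y) (f : Hom C X X')
    (g : Hom C Y Y') (j : Hom C X' Y') :
  is_pushout i f g j -> is_pushout f i j g.
Proof.
move=> po; split=> [|W u v uv]; first by case: po.
have [|w [wg wj]] := pushout_desc (u := v) (v := u) po; first by rewrite uv.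
exists w; split=> [|w' [wj' wg']]; first by split.
by apply: (pushout_joint_epi po); rewrite ?wg ?wj.
Qed.

Lemma pushout_iso X Y X' Y1 Y2 (i : Hom C X Y) (f : Hom C X X')
    (g1 : Hom C Y Y1) (j1 : Hom C X' Y1) (g2 : Hom C Y Y2) (j2 : Hom C X' Y2) :
  is_pushout i f g1 j1 -> is_pushout i f g2 j2 ->
  exists a : Hom C Y1 Y2, [/\ is_iso a, a ∘ g1 = g2 & a ∘ j1 = j2].
Proof.
move=> po1 po2; have [a [ag aj]] := pushout_desc po1 (proj1 po2).
have [b [bg bj]] := pushout_desc po2 (proj1 po1).
exists a; split=> //; exists b; split.
  by apply: (pushout_joint_epi po1); rewrite comp1m -compA ?ag ?aj.
by apply: (pushout_joint_epi po2); rewrite comp1m -compA ?bg ?bj.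
Qed.

Lemma pushout_cokernel X Y X' Y' Z (i : Hom C X Y) (f : Hom C X X')
    (g : Hom C Y Y') (j : Hom C X' Y') (p : Hom C Y Z) :
  is_pushout i f g j -> is_cokernel i p ->
  exists q : Hom C Y' Z, [/\ is_cokernel j q, q ∘ g = p & q ∘ j = 0].
Proof.
move=> po cok; have [|q [qg qj]] := pushout_desc (u := p) (v := 0) po.
  by rewrite comp0m (proj1 cok).
exists q; split=> //; split=> // W u uj.
have [|w wp] := cokernel_desc (f := u ∘ g) cok.
  by rewrite -compA (proj1 po) compA uj comp0m.
exists w; split.
  by apply: (pushout_joint_epi po); rewrite -compA ?qg ?qj ?compm0 ?uj.
by move=> w' w'q; apply: (cokernel_epi cok); rewrite wp -qg compA w'q.
Qed.

End KernelCokernel.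

Section InjectiveExtension.
Variables (k : fieldType) (T : Type) (E : excat k T).

(** The form of injectivity that constructions use. In an exact category it follows
    from Ext-injectivity by push-out; in the monomorphism category it is obtained
    from the two components, without push-outs of monomorphisms. *)
Definition extends_to I : Prop :=
  forall X M (i : Hom E X M) (a : Hom E X I), inflation i -> exists b, b ∘ i = a.

Hypothesis conf_kercoker : forall X Y Z (i : Hom E X Y) (p : Hom E Y Z),
  conflation E i p -> kercoker i p.

Lemma conf0 X Y Z (i : Hom E X Y) (p : Hom E Y Z) : conflation E i p -> p ∘ i = 0.
Proof. by move=> /conf_kercoker [[]]. Qed.

Lemma extends_to_injective I : extends_to I -> ext_injective E I.
Proof.
move=> extI Z [M i p c] /=; have [ker cok] := conf_kercoker c.
have [|r ri] := extI _ _ i (idm E I); first by exists Z, p.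
have [|s sp] := cokernel_desc (f := idm E M - i ∘ r) cok.
  by rewrite compBl -compA ri comp1m compm1 subrr.
exists r, s; split=> //=; last by rewrite sp addrC subrK.
apply: (cokernel_epi cok); rewrite comp1m -compA sp compBr compA.
by rewrite (proj1 cok) comp0m subr0 compm1.
Qed.

Lemma completion X I Z X' I' Z' (i : Hom E X I) (p : Hom E I Z)
    (i' : Hom E X' I') (p' : Hom E I' Z') (f : Hom E X X') :
  conflation E i p -> conflation E i' p' -> extends_to I' ->
  exists (g : Hom E I I') (h : Hom E Z Z'), g ∘ i = i' ∘ f /\ h ∘ p = p' ∘ g.
Proof.
move=> c c' extI; have [ker cok] := conf_kercoker c.
have [|g gi] := extI _ _ i (i' ∘ f); first by exists Z, p.
have [|h hp] := cokernel_desc (f := p' ∘ g) cok.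
  by rewrite -compA gi compA (conf0 c') comp0m.
by exists g, h.
Qed.

(** The difference of the middle morphisms kills [i], so it is [t ∘ p]; then
    [h - h' = p' ∘ t] factors through the injective [I']. *)
Lemma completion_unique X I Z X' I' Z' (i : Hom E X I) (p : Hom E I Z)
    (i' : Hom E X' I') (p' : Hom E I' Z') (f : Hom E X X')
    (g g' : Hom E I I') (h h' : Hom E Z Z') :
  conflation E i p -> conflation E i' p' -> ext_injective E I' ->
  g ∘ i = i' ∘ f -> h ∘ p = p' ∘ g -> g' ∘ i = i' ∘ f -> h' ∘ p = p' ∘ g' ->
  st h = st h'.
Proof.
move=> c c' injI gi hp gi' hp'; have [ker cok] := conf_kercoker c.
have [|t tp] := cokernel_desc (f := g - g') cok.
  by rewrite compBl gi gi' subrr.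
apply/st_eq; have -> : h - h' = p' ∘ t; last exact: null_through.
by apply: (cokernel_epi cok); rewrite -compA tp compBl compBr hp hp'.
Qed.

(** Suspensions computed from different injective hulls can therefore be compared,
    in particular those of the monomorphism category with those of [E]. *)
Lemma cosyzygy_iso X I Z I' Z' (i : Hom E X I) (p : Hom E I Z)
    (i' : Hom E X I') (p' : Hom E I' Z') (g : Hom E I I') (h : Hom E Z Z') :
  conflation E i p -> conflation E i' p' ->
  extends_to I -> extends_to I' ->
  g ∘ i = i' -> h ∘ p = p' ∘ g -> is_iso (st h).
Proof.
move=> c c' extI extI' gi hp.
have [g' [h' [gi' hp']]] := completion (idm E X) c' c extI.
exists (st h'); rewrite /is_inverse -!stM -!st1; split.
  apply: (completion_unique (f := idm E X) (g := g' ∘ g) (g' := idm E I) c c).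
  - exact: extends_to_injective.
  - by rewrite -compA gi gi'.
  - by rewrite -compA hp compA hp' compA.
  - by rewrite comp1m compm1.
  - by rewrite comp1m compm1.
apply: (completion_unique (f := idm E X) (g := g ∘ g') (g' := idm E I') c' c').
- exact: extends_to_injective.
- by rewrite -compA gi' compm1 gi compm1.
- by rewrite -compA hp' compA hp compA.
- by rewrite comp1m compm1.
- by rewrite comp1m compm1.
Qed.

End InjectiveExtension.

Section QuillenExact.
Variables (k : fieldType) (T : Type) (E : excat k T).
Hypothesis qE : quillen_exact E.

Lemma inflation_conflation X Y Z (i : Hom E X Y) (p : Hom E Y Z) :
  inflation i -> is_cokernel i p -> conflation E i p.
Proof.
move=> [Z' [p' c]] cok; have [_ cok'] := qe_kercoker qE c.
have [a [aP ap]] := cokernel_iso cok' cok.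
apply: (qe_iso qE (is_iso_id E X) (is_iso_id E Y) aP _ _ c).
  by rewrite comp1m compm1.
by rewrite compm1.
Qed.

Lemma deflation_conflation X Y Z (i : Hom E X Y) (p : Hom E Y Z) :
  deflation p -> is_kernel i p -> conflation E i p.
Proof.
move=> [X' [i' c]] ker; have [ker' _] := qe_kercoker qE c.
have [a [aP ia]] := kernel_iso ker' ker.
apply: (qe_iso qE aP (is_iso_id E Y) (is_iso_id E Z) _ _ c).
  by rewrite comp1m ia.
by rewrite compm1 comp1m.
Qed.

Lemma inflation_iso X Y Y' (i : Hom E X Y) (a : Hom E Y Y') :
  inflation i -> is_iso a -> inflation (a ∘ i).
Proof.
move=> [Z [p c]] [b [ba ab]]; exists Z, (p ∘ b).
apply: (qe_iso qE (is_iso_id E X) _ (is_iso_id E Z) (b := a) _ _ c).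
- by exists b.
- by rewrite compm1.
- by rewrite comp1m -compA ba compm1.
Qed.

(** The axiom provides one push-out with this property; any other is isomorphic to
    it under [X']. *)
Lemma pushout_inflation X Y X' Y' (i : Hom E X Y) (f : Hom E X X')
    (g : Hom E Y Y') (j : Hom E X' Y') :
  is_pushout i f g j -> inflation i -> inflation j.
Proof.
move=> po /(qe_pushout qE f) [Y2 [g2 [j2 [po2 j2P]]]].
have [a [aP ag aj]] := pushout_iso po2 po.
by rewrite -aj; apply: inflation_iso.
Qed.

Lemma pushout_conflation X Y X' Y' Z (i : Hom E X Y) (f : Hom E X X')
    (g : Hom E Y Y') (j : Hom E X' Y') (p : Hom E Y Z) :
  is_pushout i f g j -> conflation E i p ->
  exists q : Hom E Y' Z, [/\ conflation E j q, q ∘ g = p & q ∘ j = 0].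
Proof.
move=> po c; have [ker cok] := qe_kercoker qE c.
have [q [qcok qg qj]] := pushout_cokernel po cok.
exists q; split=> //; apply: inflation_conflation => //.
by apply: pushout_inflation po _; exists Z, p.
Qed.

Lemma pullback_conflation X Y Z W (i : Hom E X Y) (p : Hom E Y Z) (g : Hom E W Z) :
  conflation E i p ->
  exists Q (j : Hom E X Q) (q : Hom E Q W) (b : Hom E Q Y),
    [/\ conflation E j q, b ∘ j = i & p ∘ b = g ∘ q].
Proof.
move=> c; have [ker cok] := qe_kercoker qE c.
have [|Q [q [b [[bq pb] qP]]]] := qe_pullback qE (p := p) g; first by exists X, i.
have [|j [[bj qj] _]] := pb X i 0; first by rewrite compm0 (proj1 ker).
have pb_mono W' (u v : Hom E W' Q) : b ∘ u = b ∘ v -> q ∘ u = q ∘ v -> u = v.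
  move=> bu qu; have [|w [_ wP]] := pb _ (b ∘ u) (q ∘ u).
    by rewrite !compA bq.
  by rewrite -(wP u) // -(wP v).
exists Q, j, q, b; split=> //; apply: deflation_conflation => //; split=> // W' u qu.
have [|v vP] := kernel_lift (f := b ∘ u) ker.
  by rewrite compA bq -compA qu compm0.
exists v; split.
  by apply: pb_mono; rewrite compA ?bj ?qj ?comp0m ?qu.
by move=> v' v'P; apply: (kernel_mono ker); rewrite vP -v'P compA bj.
Qed.

Lemma injective_extends I : ext_injective E I -> extends_to E I.
Proof.
move=> injI X M i a iP; have [Y' [g [j [po [Z [q c]]]]]] := qe_pushout qE a iP.
have [r [s [rj _ _]]] := injI _ (Ext c); rewrite /= in rj.
by exists (r ∘ g); rewrite -compA (proj1 po) compA rj comp1m.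
Qed.

(** The kernel of the deflation [idm E W] is a zero object, hence can be replaced
    by [O]. *)
Lemma zero_conflation_left O W : is_zero E O -> conflation E (0 : Hom E O W) (idm E W).
Proof.
move=> [O1 O2]; have [K [i c]] := qe_def1 qE W.
have [ker cok] := qe_kercoker qE c.
have i0 : i = 0 by rewrite -[i]comp1m (proj1 ker).
have K1 : idm E K = 0.
  by apply: (kernel_mono ker); rewrite compm1 compm0 i0.
apply: (qe_iso qE (a := 0) _ (is_iso_id E W) (is_iso_id E W) _ _ c).
- exists 0; split; first by rewrite compm0 K1.
  by rewrite compm0 (O1 _ (idm E O)).
- by rewrite i0 !compm0.
- by rewrite compm1.
Qed.

Lemma zero_conflation_right O W : is_zero E O -> conflation E (idm E W) (0 : Hom E W O).
Proof.
move=> [O1 O2]; have [K [p c]] := qe_inf1 qE W.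
have [ker cok] := qe_kercoker qE c.
have p0 : p = 0 by rewrite -[p]compm1 (proj1 ker).
have K1 : idm E K = 0.
  by apply: (cokernel_epi cok); rewrite comp1m comp0m p0.
apply: (qe_iso qE (c := 0) (is_iso_id E W) (is_iso_id E W) _ _ _ c).
- exists 0; split; first by rewrite compm0 K1.
  by rewrite compm0 (O1 _ (idm E O)).
- by rewrite compm1.
- by rewrite !comp0m.
Qed.

Lemma is_zero_extends O : is_zero E O -> extends_to E O.
Proof. by move=> [O1 O2] X M i a _; exists 0; rewrite comp0m (O2 _ a). Qed.

Lemma retract_extends I J (r : Hom E J I) (s : Hom E I J) :
  r ∘ s = idm E I -> extends_to E J -> extends_to E I.
Proof.
move=> rs extJ X M i a /extJ - /(_ (s ∘ a)) [b bi].
by exists (r ∘ b); rewrite -compA bi compA rs comp1m.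
Qed.

End QuillenExact.

(** * The monomorphism category *)

Section MonoCategory.
Variables (k : fieldType) (T : Type) (E : excat k T).
Local Notation M := (monocat E).

Definition on_src f g (u : Hom M f g) : Hom E (msrc f) (msrc g) := (monoval u).1.
Definition on_tgt f g (u : Hom M f g) : Hom E (mtgt f) (mtgt g) := (monoval u).2.

Lemma squareP f g (u : Hom M f g) : on_tgt u ∘ marr f = marr g ∘ on_src u.
Proof. exact/eqP/(monovalP u). Qed.

Fact square_subproof f g (a : Hom E (msrc f) (msrc g)) (b : Hom E (mtgt f) (mtgt g)) :
  b ∘ marr f = marr g ∘ a -> (a, b) \in @commsq _ _ E f g.
Proof. by move=> ba; apply/eqP. Qed.

Definition square f g (a : Hom E (msrc f) (msrc g)) (b : Hom E (mtgt f) (mtgt g))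
    (ba : b ∘ marr f = marr g ∘ a) : Hom M f g :=
  MonoHom (square_subproof ba).

Lemma square_ext f g (u v : Hom M f g) :
  on_src u = on_src v -> on_tgt u = on_tgt v -> u = v.
Proof.
by move: u v => [[u1 u2] uP] [[v1 v2] vP] e1 e2; apply/val_inj; congr (_, _).
Qed.

Definition src_functor : lfunctor M E :=
  @LFunctor k _ _ M E (@msrc k T E) on_src (fun _ _ _ _ _ => erefl)
    (fun _ => erefl) (fun _ _ _ _ _ => erefl).

Definition tgt_functor : lfunctor M E :=
  @LFunctor k _ _ M E (@mtgt k T E) on_tgt (fun _ _ _ _ _ => erefl)
    (fun _ => erefl) (fun _ _ _ _ _ => erefl).

Hypothesis qE : quillen_exact E.

Lemma mono_kercoker f g h (i : Hom M f g) (p : Hom M g h) :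
  conflation M i p -> kercoker i p.
Proof.
move=> [/(qe_kercoker qE) [ker1 cok1] /(qe_kercoker qE) [ker2 cok2]].
have pi : p ∘ i = 0 by apply: square_ext; [exact: (proj1 ker1) | exact: (proj1 ker2)].
split; split=> // w u u0.
- have [|v1 v1P] := kernel_lift (f := on_src u) ker1.
    exact: (congr1 (@on_src w h) u0).
  have [|v2 v2P] := kernel_lift (f := on_tgt u) ker2.
    exact: (congr1 (@on_tgt w h) u0).
  have vv : v2 ∘ marr w = marr f ∘ v1.
    apply: (kernel_mono ker2); rewrite !compA v2P squareP -v1P compA.
    by congr (_ ∘ _); rewrite (squareP i).
  exists (square vv); split; first by apply: square_ext; [exact: v1P | exact: v2P].
  move=> v vP; apply: square_ext.
    by apply: (kernel_mono ker1); rewrite v1P -vP.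
  by apply: (kernel_mono ker2); rewrite v2P -vP.
- have [|v1 v1P] := cokernel_desc (f := on_src u) cok1.
    exact: (congr1 (@on_src f w) u0).
  have [|v2 v2P] := cokernel_desc (f := on_tgt u) cok2.
    exact: (congr1 (@on_tgt f w) u0).
  have vv : v2 ∘ marr h = marr w ∘ v1.
    apply: (cokernel_epi cok1); rewrite -!compA v1P -squareP -v2P -compA.
    by congr (_ ∘ _); rewrite -(squareP p).
  exists (square vv); split; first by apply: square_ext; [exact: v1P | exact: v2P].
  move=> v vP; apply: square_ext.
    by apply: (cokernel_epi cok1); rewrite v1P -vP.
  by apply: (cokernel_epi cok2); rewrite v2P -vP.
Qed.

(** Since [msrc J] is injective, [J] splits by some [rho]. The part of [a] that goes
    to [msrc J] extends by [mu]. The remaining part [a2] vanishes on [msrc A], and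
    its extension must vanish on [msrc N]: the value of an arbitrary extension [r0]
    there factors through the deflation [on_src p], so that it extends to a
    morphism [e] on [mtgt G], which is subtracted. *)
Lemma mono_extends (J : mono E) :
  extends_to E (msrc J) -> extends_to E (mtgt J) -> extends_to M J.
Proof.
move=> ext1 ext2 A N i a [G [p [c1 c2]]].
have [ker1 cok1] := qe_kercoker qE c1; have [ker2 cok2] := qe_kercoker qE c2.
have i2P : inflation (on_tgt i) by exists (mtgt G), (on_tgt p).
have [rho rhoP] := ext1 _ _ _ (idm E _) (marrP J).
have [mu muP] := ext1 _ _ _ (rho ∘ on_tgt a) i2P.
pose a2 := on_tgt a - marr J ∘ rho ∘ on_tgt a.
have a2A : a2 ∘ marr A = 0.
  rewrite compBl -!compA squareP [rho ∘ _]compA rhoP.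
  by rewrite comp1m subrr.
have [r0 r0P] := ext2 _ _ _ a2 i2P.
have [|e' e'P] := cokernel_desc (f := r0 ∘ marr N) cok1.
  by rewrite -compA -squareP compA r0P.
have [e eP] := ext2 _ _ _ e' (marrP G).
pose mu1 := mu ∘ marr N; pose mu2 := r0 - e ∘ on_tgt p + marr J ∘ mu.
have mm : mu2 ∘ marr N = marr J ∘ mu1.
  rewrite /mu2 /mu1 compDl compBl -(compA e) squareP.
  by rewrite compA eP e'P subrr add0r compA.
exists (square mm); apply: square_ext.
  change (mu1 ∘ on_src i = on_src a).
  by rewrite /mu1 -compA -squareP compA muP -compA squareP compA rhoP comp1m.
change (mu2 ∘ on_tgt i = on_tgt a).
rewrite /mu2 compDl compBl -(compA e) (proj1 cok2).
by rewrite compm0 subr0 r0P -compA muP /a2 [marr J ∘ (_ ∘ _)]compA subrK.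
Qed.

(** An extension of [mtgt J] by [Z] underlies an extension of [J] by the object
    with zero source and target [Z]. *)
Lemma mono_injective_tgt (J : mono E) : ext_injective M J -> ext_injective E (mtgt J).
Proof.
move=> injJ; have [O O0] := proj1 (qe_additive qE).
move=> Z [N i p c] /=.
have iJ : inflation (i ∘ marr J).
  by apply: qe_infM (marrP J) => //; exists Z, p.
have OZ : inflation (0 : Hom E O Z).
  by exists Z, (idm E Z); apply: zero_conflation_left.
have ii : i ∘ marr J = marr (Mono iJ) ∘ idm E (msrc J) by rewrite compm1.
have pp : p ∘ marr (Mono iJ) = marr (Mono OZ) ∘ (0 : Hom E (msrc J) O).
  by rewrite /= compm0 compA (conf0 (qe_kercoker qE) c) comp0m.
have cc : conflation M (square (f := J) (g := Mono iJ) ii) (square (g := Mono OZ) pp).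
  by split=> //=; apply: zero_conflation_right.
have [r [s [ri ps rs]]] := injJ _ (Ext cc).
exists (on_tgt r), (on_tgt s); split.
- exact: (congr1 (@on_tgt _ _) ri).
- exact: (congr1 (@on_tgt _ _) ps).
- exact: (congr1 (@on_tgt _ _) rs).
Qed.

(** Push-out along [marr J] turns an extension of [msrc J] by [Z] into an extension
    of [J] by the identity of [Z]. *)
Lemma mono_injective_src (J : mono E) : ext_injective M J -> ext_injective E (msrc J).
Proof.
move=> injJ Z [N i p c] /=.
have iP : inflation i by exists Z, p.
have [Q [g [j [po jP]]]] := qe_pushout qE (marr J) iP.
have [q [qc qg qj]] := pushout_conflation qE po c.
have gP : inflation g by apply: pushout_inflation (pushout_sym po) (marrP J).
have ii : j ∘ marr J = marr (Mono gP) ∘ i by rewrite /= (proj1 po).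
have pp : q ∘ marr (Mono gP) = marr (Mono (qe_inf1 qE Z)) ∘ p.
  by rewrite /= comp1m.
have cc : conflation M (square (f := J) (g := Mono gP) ii)
    (square (g := Mono (qe_inf1 qE Z)) pp) by split.
have [r [s [ri ps rs]]] := injJ _ (Ext cc).
exists (on_src r), (on_src s); split.
- exact: (congr1 (@on_src _ _) ri).
- exact: (congr1 (@on_src _ _) ps).
- exact: (congr1 (@on_src _ _) rs).
Qed.

(** An inflation with injective source splits, so the cokernel is a retract of the
    injective target. *)
Lemma mono_injective_cokernel (J : mono E) K (p : Hom E (mtgt J) K) :
  ext_injective M J -> conflation E (marr J) p -> ext_injective E K.
Proof.
move=> injJ c; apply: (extends_to_injective (qe_kercoker qE)).
have [r [s [_ ps _]]] := mono_injective_src injJ (Ext c).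
apply: (retract_extends ps); apply: injective_extends => //.
exact: mono_injective_tgt.
Qed.

Lemma mono_injective_extends (J : mono E) : ext_injective M J -> extends_to M J.
Proof.
move=> injJ; apply: mono_extends; apply: injective_extends => //.
  exact: mono_injective_src.
exact: mono_injective_tgt.
Qed.

Definition stab_src := stab_functor (F := src_functor) mono_injective_src.
Definition stab_tgt := stab_functor (F := tgt_functor) mono_injective_tgt.

Lemma stab_srcE f g (u : Hom M f g) : fhom stab_src (st u) = st (on_src u).
Proof. exact: stab_functorE. Qed.

Lemma stab_tgtE f g (u : Hom M f g) : fhom stab_tgt (st u) = st (on_tgt u).
Proof. exact: stab_functorE. Qed.

(** Taking cokernels induces a functor of stable categories, because it sends
    injective objects to injective objects. *)
Lemma null_cokernel f g (u : Hom M f g) Z (p : Hom E (mtgt f) Z)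
    W (q : Hom E (mtgt g) W) (c : Hom E Z W) :
  conflation E (marr f) p -> conflation E (marr g) q ->
  c ∘ p = q ∘ on_tgt u -> null u -> null c.
Proof.
move=> pc qc cp nu; elim: nu c cp => [|{}u J h v _ IH injJ] c cp.
  suff -> : c = 0 by apply: null_zero.
  apply: (cokernel_epi (proj2 (qe_kercoker qE pc))).
  by rewrite cp comp0m; apply: compm0.
have [K [l lc]] := marrP J.
have [|cv cvP] := cokernel_desc (f := l ∘ on_tgt v) (proj2 (qe_kercoker qE pc)).
  by rewrite -compA squareP compA (conf0 (qe_kercoker qE) lc) comp0m.
have [|ch chP] := cokernel_desc (f := q ∘ on_tgt h) (proj2 (qe_kercoker qE lc)).
  by rewrite -compA squareP compA (conf0 (qe_kercoker qE) qc) comp0m.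
rewrite -(subrK (ch ∘ cv) c); apply: null_add; last exact: mono_injective_cokernel lc.
apply: IH; rewrite compBl cp -compA cvP compA chP -compA.
change (on_tgt (u + h ∘ v)) with (on_tgt u + on_tgt h ∘ on_tgt v).
by rewrite compDr addrK.
Qed.

Lemma cokernel_map f g (u : Hom M f g) Z (p : Hom E (mtgt f) Z)
    W (q : Hom E (mtgt g) W) :
  conflation E (marr f) p -> conflation E (marr g) q ->
  exists c : Hom E Z W, c ∘ p = q ∘ on_tgt u.
Proof.
move=> pc qc; apply: (cokernel_desc (proj2 (qe_kercoker qE pc))).
by rewrite -compA squareP compA (conf0 (qe_kercoker qE) qc) comp0m.
Qed.

Lemma iso_cokernel f g Z (p : Hom E (mtgt f) Z) W (q : Hom E (mtgt g) W) :
  conflation E (marr f) p -> conflation E (marr g) q ->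
  isomorphic (stab M) f g -> arr_iso (st p) (st q).
Proof.
move=> pc qc [u' [v' [vu uv]]].
have [u uE] := st_surj u'; have [v vE] := st_surj v'; subst u' v'.
have [c cp] := cokernel_map u pc qc; have [e ep] := cokernel_map v qc pc.
have ce_iso h h' (w : Hom M h h') (w' : Hom M h' h) Y (l : Hom E (mtgt h) Y)
    Y' (l' : Hom E (mtgt h') Y') (a : Hom E Y Y') (b : Hom E Y' Y) :
  conflation E (marr h) l -> conflation E (marr h') l' ->
  a ∘ l = l' ∘ on_tgt w -> b ∘ l' = l ∘ on_tgt w' ->
  st w' ∘ st w = idm (stab M) h -> st b ∘ st a = idm (stab E) Y.
  move=> lc lc' al bl' /eqP; rewrite -subr_eq0 -stM -st1 -stN -stD => /eqP /st_eq0 nw.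
  rewrite -st1 -stM; apply/st_eq; apply: (null_cokernel lc lc _ nw).
  rewrite compBl comp1m -compA al compA bl'.
  change (on_tgt (w' ∘ w - idm M h)) with (on_tgt w' ∘ on_tgt w - idm E (mtgt h)).
  by rewrite compBr compm1 compA.
exists (fhom stab_tgt (st u)), (st c); split.
- by apply: (fhom_is_iso stab_tgt (f := st u)); exists (st v).
- exists (st e); split; first exact: ce_iso pc qc cp ep vu.
  exact: ce_iso qc pc ep cp uv.
- by rewrite stab_tgtE -!stM cp.
Qed.

Lemma iso_arr_iso f g : isomorphic (stab M) f g -> arr_iso (st (marr f)) (st (marr g)).
Proof.
move=> [u' uP]; have [u uE] := st_surj u'; subst u'.
exists (st (on_src u)), (st (on_tgt u)); split.
- by rewrite -stab_srcE; apply: (fhom_is_iso stab_src (f := st u)).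
- by rewrite -stab_tgtE; apply: (fhom_is_iso stab_tgt (f := st u)).
- by rewrite -!stM squareP.
Qed.

Lemma null_extend X Y Z (f : Hom E X Y) (n : Hom E X Z) :
  inflation f -> null n -> exists n', null n' /\ n' ∘ f = n.
Proof.
move=> fP; elim=> [|{}n I h g _ [n' [nn' n'f]] injI].
  by exists 0; split; [apply: null_zero | rewrite comp0m].
have [g' g'f] := injective_extends qE injI g fP.
exists (n' + h ∘ g'); split; first exact: null_add.
by rewrite compDl n'f -compA g'f.
Qed.

(** This construction is right adjoint to the target functor and left adjoint to
    the source functor, with unit [diag_unit] and counit [diag_counit]. *)
Definition diag_mono W : mono E := Mono (qe_inf1 qE W).

Fact diag_subproof X Y (u : Hom E X Y) :
  u ∘ marr (diag_mono X) = marr (diag_mono Y) ∘ u.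
Proof. by rewrite /= comp1m compm1. Qed.

Definition diag_hom X Y (u : Hom E X Y) : Hom M (diag_mono X) (diag_mono Y) :=
  square (f := diag_mono X) (g := diag_mono Y) (diag_subproof u).

Definition diag_functor : lfunctor E M.
Proof.
apply: (@LFunctor k _ _ E M diag_mono diag_hom).
- by move=> X Y a u v; apply: square_ext.
- by move=> X; apply: square_ext.
- by move=> X Y Z g f; apply: square_ext.
Defined.

Lemma diag_injective I : ext_injective E I -> ext_injective M (diag_functor I).
Proof.
move=> injI; apply: (extends_to_injective mono_kercoker).
by apply: mono_extends; apply: injective_extends.
Qed.

Definition stab_diag := stab_functor (F := diag_functor) diag_injective.

Lemma stab_diagE X Y (u : Hom E X Y) :
  fhom stab_diag (st u) = st (diag_hom u).
Proof. exact: stab_functorE. Qed.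

Fact diag_unit_subproof f : idm E (mtgt f) ∘ marr f = marr (diag_mono (mtgt f)) ∘ marr f.
Proof. by []. Qed.

Definition diag_unit f : Hom M f (diag_mono (mtgt f)) :=
  square (g := diag_mono (mtgt f)) (diag_unit_subproof f).

Fact diag_counit_subproof f :
  marr f ∘ marr (diag_mono (msrc f)) = marr f ∘ idm E (msrc f).
Proof. by []. Qed.

Definition diag_counit f : Hom M (diag_mono (msrc f)) f :=
  square (f := diag_mono (msrc f)) (diag_counit_subproof f).

Section ZeroSource.
Variables (O : T) (O0 : is_zero E O).

Fact zero_mono_subproof W : inflation (0 : Hom E O W).
Proof. by exists W, (idm E W); apply: zero_conflation_left. Qed.

(** This construction is right adjoint to the cokernel functor and left adjoint to
    the target functor, with unit [zero_unit] and counit [zero_counit]. *)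
Definition zero_mono W : mono E := Mono (zero_mono_subproof W).

Fact zero_subproof X Y (u : Hom E X Y) :
  u ∘ marr (zero_mono X) = marr (zero_mono Y) ∘ idm E O.
Proof. by rewrite /= comp0m compm0. Qed.

Definition zero_hom X Y (u : Hom E X Y) : Hom M (zero_mono X) (zero_mono Y) :=
  square (f := zero_mono X) (g := zero_mono Y) (zero_subproof u).

Definition zero_functor : lfunctor E M.
Proof.
apply: (@LFunctor k _ _ E M zero_mono zero_hom).
- move=> X Y a u v; apply: square_ext => //.
  have z (w : Hom E O O) : w = 0 := proj1 O0 O w.
  by change (idm E O = a *: idm E O + idm E O); rewrite [LHS]z [RHS]z.
- by move=> X; apply: square_ext.
- by move=> X Y Z g f; apply: square_ext => //; apply/esym/comp1m.
Defined.

Lemma zero_injective I : ext_injective E I -> ext_injective M (zero_functor I).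
Proof.
move=> injI; apply: (extends_to_injective mono_kercoker).
by apply: mono_extends; [apply: is_zero_extends | apply: injective_extends].
Qed.

Definition stab_zero := stab_functor (F := zero_functor) zero_injective.

Lemma stab_zeroE X Y (u : Hom E X Y) :
  fhom stab_zero (st u) = st (zero_hom u).
Proof. exact: stab_functorE. Qed.

Fact zero_counit_subproof f :
  idm E (mtgt f) ∘ marr (zero_mono (mtgt f)) = marr f ∘ (0 : Hom E O (msrc f)).
Proof. by rewrite compm0; apply: compm0. Qed.

Definition zero_counit f : Hom M (zero_mono (mtgt f)) f :=
  square (f := zero_mono (mtgt f)) (zero_counit_subproof f).

Fact zero_unit_subproof f Z (p : Hom E (mtgt f) Z) (pc : conflation E (marr f) p) :
  p ∘ marr f = marr (zero_mono Z) ∘ (0 : Hom E (msrc f) O).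
Proof. by rewrite compm0 (conf0 (qe_kercoker qE) pc). Qed.

Definition zero_unit f Z (p : Hom E (mtgt f) Z) (pc : conflation E (marr f) p) :
  Hom M f (zero_mono Z) :=
  square (g := zero_mono Z) (zero_unit_subproof pc).

End ZeroSource.

(** A square that is stably trivial in each degree need not be trivial, but it has a
    normal form: its source component extends to [s : Hom E (mtgt f) (msrc g)], and
    subtracting the square that [s] induces through a diagonal object leaves a
    square with source component zero, hence one that factors through the
    cokernel of [f]. *)
Lemma null_components f g (u : Hom M f g) Z (p : Hom E (mtgt f) Z) :
  conflation E (marr f) p -> null (on_src u) -> null (on_tgt u) ->
  exists (t : Hom E Z (mtgt g)) (v : Hom M f g),
    [/\ st u = st v, on_src v = 0, on_tgt v = t ∘ p & null (t ∘ p)].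
Proof.
move=> pc n1 n2; have [s [ns sf]] := null_extend (marrP f) n1.
pose w := diag_counit g ∘ diag_hom s ∘ diag_unit f.
have nw : null w.
  by apply: null_compr; apply: null_compl; apply: (fhom_null diag_injective ns).
have w1 : on_src w = on_src u.
  by rewrite -sf; change (idm E _ ∘ s ∘ marr f = s ∘ marr f); rewrite comp1m.
have w2 : on_tgt w = marr g ∘ s.
  by change (marr g ∘ s ∘ idm E _ = marr g ∘ s); rewrite compm1.
have [|t tp] := cokernel_desc (f := on_tgt (u - w)) (proj2 (qe_kercoker qE pc)).
  rewrite squareP; change (on_src (u - w)) with (on_src u - on_src w).
  by rewrite w1 subrr compm0.
exists t, (u - w); split=> //.
- by apply/st_eq; rewrite opprB addrCA subrr addr0.
- by change (on_src u - on_src w = 0); rewrite w1 subrr.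
- rewrite tp; change (null (on_tgt u - on_tgt w)).
  rewrite addrC -scaleN1r; apply: null_lin => //.
  by rewrite w2; apply: null_compl.
Qed.

(** With the normal forms [(0, t ∘ p)] and [(0, s ∘ q)], the composite factors
    through the class of [s ∘ q ∘ t], in which [s ∘ q] is already trivial. So the
    squares invisible in the morphism category form an ideal of square zero. *)
Lemma null_components_comp f g h (u : Hom M f g) (v : Hom M g h) :
  null (on_src u) -> null (on_tgt u) -> null (on_src v) -> null (on_tgt v) ->
  null (v ∘ u).
Proof.
move=> nu1 nu2 nv1 nv2; have [Z [p pc]] := marrP f; have [W [q qc]] := marrP g.
have [t [u' [uu' u1 u2 nt]]] := null_components pc nu1 nu2.
have [s [v' [vv' v1 v2 ns]]] := null_components qc nv1 nv2.
have [O O0] := proj1 (qe_additive qE).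
apply/st_eq0; rewrite stM uu' vv' -stM; apply/st_eq0.
have -> : v' ∘ u' =
    zero_counit O0 h ∘ zero_hom O0 (s ∘ q ∘ t) ∘ zero_unit O0 pc.
  apply: square_ext.
    change (on_src v' ∘ on_src u' = 0 ∘ idm E O ∘ 0).
    by rewrite v1 comp0m compm0.
  change (on_tgt v' ∘ on_tgt u' = idm E _ ∘ (s ∘ q ∘ t) ∘ p).
  by rewrite v2 u2 comp1m !compA.
apply: null_compr; apply: null_compl.
apply: (fhom_null (zero_injective (O0 := O0)) (f := s ∘ q ∘ t)).
exact: null_compr.
Qed.

(** The defect of commutativity factors through injectives, so it extends along
    the inflation [f], and the extension is absorbed into [b]. *)
Lemma square_full f g (a : Hom E (msrc f) (msrc g)) (b : Hom E (mtgt f) (mtgt g)) :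
  st b ∘ st (marr f) = st (marr g) ∘ st a ->
  exists u : Hom M f g, st (on_src u) = st a /\ st (on_tgt u) = st b.
Proof.
rewrite -!stM => /st_eq nba.
have [n [nn nf]] := null_extend (marrP f) nba.
have ba : (b - n) ∘ marr f = marr g ∘ a by rewrite compBl nf opprB addrCA subrr addr0.
exists (square ba); split=> //; apply/st_eq; change (null (b - n - b)).
rewrite addrAC subrr add0r -scaleN1r -[_ *: _]addr0.
by apply: null_lin => //; apply: null_zero.
Qed.

(** Such a morphism is the identity plus an element of square zero. *)
Lemma components_id_iso f (q : Hom (stab M) f f) :
  fhom stab_src q = idm (stab E) _ -> fhom stab_tgt q = idm (stab E) _ -> is_iso q.
Proof.
have [u ->] := st_surj q; rewrite stab_srcE stab_tgtE -!st1 => /st_eq n1 /st_eq n2.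
pose n := u - idm M f.
have nn : st n ∘ st n = 0 by rewrite -stM; apply/st_eq0; apply: null_components_comp.
have -> : st u = idm (stab M) f + st n by rewrite /n stD stN st1 addrC subrK.
exists (idm (stab M) f - st n).
by split; rewrite ?(compBl, compBr, compDl, compDr) !(comp1m, compm1) nn addr0 addrK.
Qed.

(** The functor to the morphism category of the stable category is full and detects
    isomorphisms, which is enough to recover objects although it is not
    faithful. *)
Lemma arr_iso_iso f g :
  arr_iso (st (marr f)) (st (marr g)) -> isomorphic (stab M) f g.
Proof.
move=> fg; have [b' [a' [iso_b' iso_a' sq']]] := arr_iso_sym fg.
case: fg => a [b [[a1 [a1a aa1]] [b1 [b1b bb1]] sq]].
have sq1 : b1 ∘ st (marr g) = st (marr f) ∘ a1.
  by rewrite -[LHS]compm1 -aa1 !compA -[b1 ∘ _ ∘ a]compA -sq compA b1b comp1m.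
have [a0 aE] := st_surj a; have [b0 bE] := st_surj b.
have [a10 a1E] := st_surj a1; have [b10 b1E] := st_surj b1; subst a b a1 b1.
have [u [u1 u2]] := square_full sq; have [v [v1 v2]] := square_full sq1.
exists (st u); apply: (@is_iso_lr _ _ _ _ _ _ (st v) (st v)).
  by apply: components_id_iso; rewrite fhomM ?stab_srcE ?stab_tgtE ?u1 ?u2 ?v1 ?v2.
by apply: components_id_iso; rewrite fhomM ?stab_srcE ?stab_tgtE ?u1 ?u2 ?v1 ?v2.
Qed.

End MonoCategory.

(** * Rotation of monomorphisms *)

Section Rotation.
Variables (k : fieldType) (T : Type) (E : excat k T).
Local Notation M := (monocat E).
Hypotheses (qE : quillen_exact E) (enough : enough_injectives E).

(** The next morphism in the triangle of [f] is the cokernel, which need not be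
    monic; [g] is a monic model of it. *)
Definition rotation (f g : mono E) : Prop :=
  exists Z (p : Hom E (mtgt f) Z),
    conflation E (marr f) p /\ arr_iso (st p) (st (marr g)).

Lemma rotation_iso f f' g g' :
  rotation f g -> rotation f' g' -> isomorphic (stab M) f f' ->
  isomorphic (stab M) g g'.
Proof.
move=> [Z [p [pc pg]]] [Z' [p' [pc' pg']]] /(iso_cokernel qE pc pc') pp'.
apply: arr_iso_iso => //; apply: arr_iso_trans (arr_iso_sym pg) _.
exact: arr_iso_trans pp' pg'.
Qed.

(** The push-out along an injective hull of [X] replaces the cokernel [Z] by the
    stably isomorphic object [Y'], into which [Y] embeds with the cosyzygy of [X] as
    cokernel: the triangle of [f] is turned by one step. *)
Lemma rotation_step X Y Z (f : Hom E X Y) (p : Hom E Y Z) I X1 (i : Hom E X I)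
    (d : Hom E I X1) :
  conflation E f p -> conflation E i d -> ext_injective E I ->
  exists Y' (g : Hom E Y Y') (j : Hom E I Y') (q : Hom E Y' Z) (e : Hom E Y' X1),
    [/\ is_pushout f i g j, q ∘ g = p /\ q ∘ j = 0, is_iso (st q),
        conflation E g e & e ∘ g = 0 /\ e ∘ j = d].
Proof.
move=> pc dc injI; have fP : inflation f by exists Z, p.
have [Y' [g [j [po jP]]]] := qe_pushout qE i fP.
have [q [qc qg qj]] := pushout_conflation qE po pc.
have [e [ec ej eg]] := pushout_conflation qE (pushout_sym po) dc.
exists Y', g, j, q, e; split=> //.
have [r [s [_ /= qs rs]]] := injI _ (Ext qc).
exists (st s); rewrite /is_inverse -!stM qs; split=> //.
apply/st_eq; rewrite -rs opprD addrCA subrr addr0 -compNr.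
exact: null_through.
Qed.

Lemma rotation_total f : exists g, rotation f g.
Proof.
have [Z [p pc]] := marrP f.
have [I [i [injI [X1 [d dc]]]]] := enough (msrc f).
have [Y' [g [j [q [e [po [qg qj] qP ec _]]]]]] := rotation_step pc dc injI.
have gP : inflation g by exists X1, e.
exists (Mono gP), Z, p; split=> //; apply: arr_iso_sym.
exists (idm (stab E) _), (st q); split=> //; first exact: is_iso_id.
by rewrite compm1 -stM qg.
Qed.

(** Turning the triangle [X -> Y -> Z -> X1] three times gives the opposite of the
    suspended morphism [f1]. The sign is absorbed by the automorphism [-1] of [Y1],
    so that no convention on triangles matters. *)
Lemma rotation_cube X Y Z (f : Hom E X Y) (p : Hom E Y Z)
    I X1 (i : Hom E X I) (d : Hom E I X1)
    I' Y1 (i' : Hom E Y I') (d' : Hom E I' Y1)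
    (phi : Hom E I I') (f1 : Hom E X1 Y1) (fP : inflation f) (f1P : inflation f1) :
  conflation E f p -> conflation E i d -> conflation E i' d' ->
  ext_injective E I -> ext_injective E I' ->
  phi ∘ i = i' ∘ f -> f1 ∘ d = d' ∘ phi ->
  exists g g', [/\ rotation (Mono fP) g, rotation g g' & rotation g' (Mono f1P)].
Proof.
move=> pc dc dc' injI injI' phii f1d.
have [Y' [g [j [q [e [po [qg qj] qP ec [eg ej]]]]]]] := rotation_step pc dc injI.
have [Y'' [g' [j' [q' [e' [po' [qg' qj'] qP' ec' [eg' ej']]]]]]] :=
  rotation_step ec dc' injI'.
have gP : inflation g by exists X1, e.
have gP' : inflation g' by exists Y1, e'.
exists (Mono gP), (Mono gP'); split.
- exists Z, p; split=> //; apply: arr_iso_sym.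
  exists (idm (stab E) _), (st q); split=> //; first exact: is_iso_id.
  by rewrite compm1 -stM qg.
- exists X1, e; split=> //; apply: arr_iso_sym.
  exists (idm (stab E) _), (st q'); split=> //; first exact: is_iso_id.
  by rewrite compm1 -stM qg'.
exists Y1, e'; split=> //.
exists (st q'), (- idm (stab E) Y1); split=> //.
  exact/is_isoN/is_iso_id.
rewrite compNl comp1m -stN -stM; apply/st_eq.
(* The cokernel [e'] of the second rotation satisfies [e' + f1 ∘ q' = d' ∘ psi],
   where [psi] glues [i'], [phi] and the identity of [I'] along the push-outs. *)
have [|chi [chig chij]] := pushout_desc (u := i') (v := phi) po; first by rewrite phii.
have [|psi [psig psij]] := pushout_desc (u := chi) (v := idm E I') po'.
  by rewrite chig comp1m.
have -> : - e' - f1 ∘ q' = d' ∘ - psi; last exact: null_through.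
rewrite compNr -opprD; congr (- _).
apply: (pushout_joint_epi po'); rewrite compDl -!compA ?qg' ?qj' ?psig ?psij; last first.
  by rewrite ej' !compm0 addr0 compm1.
rewrite eg' add0r; apply: (pushout_joint_epi po); rewrite -!compA ?eg ?ej ?chig ?chij //.
by rewrite compm0 (conf0 (qe_kercoker qE) dc').
Qed.

Definition rotate (f : mono E) : mono E := projT1 (cid (rotation_total f)).

Lemma rotateP f : rotation f (rotate f).
Proof. by rewrite /rotate; case: cid. Qed.

Lemma rotate_iso f g :
  isomorphic (stab M) f g -> isomorphic (stab M) (rotate f) (rotate g).
Proof. exact: rotation_iso (rotateP f) (rotateP g). Qed.

Lemma rotate_cube (S : suspension M) f :
  isomorphic (stab M) (rotate (rotate (rotate f))) (susp S f).
Proof.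
have [Z [p pc]] := marrP f.
have [c1 c2] := sconf S f.
have injJ := @shull_injective _ _ _ S f.
have [g [g' [fg gg' g'f]]] := rotation_cube (marrP f) (marrP (susp S f)) pc c1 c2
  (mono_injective_src qE injJ) (mono_injective_tgt qE injJ)
  (esym (squareP (sinf S f))) (esym (squareP (sdef S f))).
have {}fg : rotation f g by case: (f) fg.
have {}g'f : rotation g' (susp S f) by case: (susp S f) g'f.
apply: rotation_iso (rotateP _) g'f _; apply: rotation_iso (rotateP _) gg' _.
by apply: rotation_iso (rotateP _) fg _; apply: iso_refl.
Qed.

(** A rotation commutes with its own cube, which is the suspension. *)
Lemma rotate_susp (S : suspension M) f :
  isomorphic (stab M) (rotate (susp S f)) (susp S (rotate f)).
Proof.
apply: iso_trans (rotate_cube S (rotate f)); apply: rotate_iso.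
exact/iso_sym/rotate_cube.
Qed.

End Rotation.

(** * Iterated suspensions *)

Section Shift.
Variables (k : fieldType) (T : Type) (E : excat k T) (S : suspension E).
Local Notation "X ~ Y" := (isomorphic (stab E) X Y) (at level 70).

Lemma susp_desusp X : susp S (desusp S X) ~ X.
Proof. exact: (natural_iso_ob X (desuspK S)). Qed.

Lemma desusp_susp X : desusp S (susp S X) ~ X.
Proof. exact: (natural_iso_ob X (suspK S)). Qed.

Lemma shift_succ n X : shift S (n + 1) X ~ susp S (shift S n X).
Proof.
case: n => [n|[|n]]; first by rewrite -PoszD addn1; apply: iso_refl.
  by apply: iso_sym; apply: susp_desusp.
have -> : Negz n.+1 + 1 = Negz n by rewrite !NegzE -addn1 PoszD opprD subrK.
by apply: iso_sym; apply: susp_desusp.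
Qed.

Lemma shift_pred n X : shift S (n - 1) X ~ desusp S (shift S n X).
Proof.
apply: iso_trans (iso_sym (desusp_susp _)) _; apply: fob_iso.
by apply: iso_trans (iso_sym (shift_succ _ _)) _; rewrite subrK; apply: iso_refl.
Qed.

Lemma shiftD m n X : shift S (m + n) X ~ shift S m (shift S n X).
Proof.
elim/int_ind: m => [|m IH|m IH]; first by rewrite add0r; apply: iso_refl.
  rewrite -addn1 PoszD addrAC; apply: iso_trans (shift_succ _ _) _.
  exact: iso_trans (fob_iso _ IH) (iso_sym (shift_succ _ _)).
rewrite -addn1 PoszD opprD addrAC; apply: iso_trans (shift_pred _ _) _.
exact: iso_trans (fob_iso _ IH) (iso_sym (shift_pred _ _)).
Qed.

End Shift.

Section ShiftArrow.
Variables (k : fieldType) (T : Type) (E : excat k T).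
Local Notation M := (monocat E).
Hypothesis qE : quillen_exact E.
Variables (S : suspension M) (S0 : suspension E).

(** Both sides are cosyzygies of the source and the target of [m], computed from the
    components of an injective hull of [m] and from the hulls chosen in [S0]. *)
Lemma susp_arrow m :
  arr_iso (st (marr (susp S m))) (fhom (susp S0) (st (marr m))).
Proof.
have [c1 c2] := sconf S m; have injJ := @shull_injective _ _ _ S m.
have ext1 := injective_extends qE (mono_injective_src qE injJ).
have ext2 := injective_extends qE (mono_injective_tgt qE injJ).
have ext0 X : extends_to E (shull S0 X).
  by apply: injective_extends => //; apply: shull_injective.
have kE := qe_kercoker qE.
have [a [x [ai xd]]] := completion kE (idm E _) c1 (sconf S0 _) (ext0 _).
have [b [y [bi yd]]] := completion kE (idm E _) c2 (sconf S0 _) (ext0 _).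
have [g [h [gi hd]]] :=
  completion kE (marr m) (sconf S0 _) (sconf S0 (mtgt m)) (ext0 _).
rewrite (suspE gi hd); exists (st x), (st y); split.
- by apply: (cosyzygy_iso kE c1 (sconf S0 _) ext1 (ext0 _) _ xd); rewrite ai compm1.
- by apply: (cosyzygy_iso kE c2 (sconf S0 _) ext2 (ext0 _) _ yd); rewrite bi compm1.
rewrite -!stM; apply: (completion_unique kE (f := marr m)
  (g := b ∘ marr (shull S m)) (g' := g ∘ a) c1 (sconf S0 _)).
- exact: shull_injective.
- rewrite -compA; have /= <- := squareP (sinf S m).
  by rewrite compA [b ∘ _]bi compm1.
- rewrite -compA; have /= <- := squareP (sdef S m).
  by rewrite !compA yd.
- by rewrite -compA ai compm1 gi.
- by rewrite -compA xd compA hd compA.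
Qed.

Lemma desusp_arrow m :
  arr_iso (st (marr (desusp S m))) (fhom (desusp S0) (st (marr m))).
Proof.
apply: arr_iso_trans (arr_iso_sym (natural_arr_iso _ (suspK S0))) _.
apply: (fhom_arr_iso (desusp S0)).
apply: arr_iso_trans (arr_iso_sym (susp_arrow _)) _.
exact/(iso_arr_iso qE)/susp_desusp.
Qed.

Lemma shift_arrow n m :
  arr_iso (st (marr (shift S n m))) (fhom (shift S0 n) (st (marr m))).
Proof.
have [n' [F [F0 [-> -> FP]]]] : exists n' F F0,
    [/\ shift S n = fiter n' F, shift S0 n = fiter n' F0 & forall m',
        arr_iso (st (marr (F m'))) (fhom F0 (st (marr m')))].
  case: n => n'; first by exists n', (susp S), (susp S0); split=> //; apply: susp_arrow.
  by exists n'.+1, (desusp S), (desusp S0); split=> //; apply: desusp_arrow.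
elim: n' => [|n' IH]; first exact: arr_iso_refl.
apply: arr_iso_trans (FP _) _; exact: (fhom_arr_iso F0 IH).
Qed.

End ShiftArrow.

(** * Serre objects in the monomorphism category *)

Section AuslanderReitenTrace.
Variables (k : fieldType) (T : Type) (E : excat k T).
Hypothesis conf_kercoker : forall X Y Z (i : Hom E X Y) (p : Hom E Y Z),
  conflation E i p -> kercoker i p.
Hypothesis inj_extends : forall I, ext_injective E I -> extends_to E I.
Variables (X H J : T) (i0 : Hom E X J) (d0 : Hom E J H) (c0 : conflation E i0 d0).
Hypothesis injJ : ext_injective E J.

Let e0 : ext E H X := Ext c0.

Lemma classifying_map Z (e : ext E Z X) : exists v, ext_pull v e0 e.
Proof.
have [b [v [bi vd]]] :=
  completion conf_kercoker (idm E X) (econf e) c0 (inj_extends injJ).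
by exists v, b.
Qed.

Lemma classifying_unique Z (e : ext E Z X) v v' :
  ext_pull v e0 e -> ext_pull v' e0 e -> st v = st v'.
Proof.
move=> [b [bi vd]] [b' [bi' vd']].
by apply: (completion_unique conf_kercoker (econf e) c0 injJ bi _ bi').
Qed.

Section Form.
Variables (Z : T) (psi : dual (Hom (stab E) Z H)).

(** The form on extensions that corresponds to [psi] when extensions of [Z] by [X]
    are identified with stable morphisms from [Z] to the cosyzygy [H] of [X]. *)
Definition classified (e : ext E Z X) : k :=
  psi (st (projT1 (cid (classifying_map e)))).

Lemma classifiedE e v : ext_pull v e0 e -> classified e = psi (st v).
Proof.
move=> ev; rewrite /classified; case: cid => v' /= ev'.
by rewrite (classifying_unique ev ev').
Qed.

Lemma classified_form : ext_form classified.
Proof.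
split.
- move=> e e' [b [bi bd]]; have [v [b' [bi' bd']]] := classifying_map e'.
  rewrite (classifiedE (v := v) (e := e')); last by exists b'.
  apply: classifiedE; exists (b' ∘ b); split.
    by rewrite -compA bi compA bi' compm1.
  by rewrite compA bd' -compA bd comp1m.
- move=> e1 e2 e [XX [ZZ [MM [c [e' [[b [bi bd]] [b2 [bi2 bd2]]]]]]]].
  move: b bi bd => /= b bi bd.
  have [v [b' [bi' bd']]] := classifying_map e'.
  rewrite compm1 in bi'; rewrite comp1m in bd; rewrite compm1 in bi2.
  have ve : ext_pull (v ∘ (bin1 ZZ + bin2 ZZ)) e0 e.
    exists (b' ∘ b2); split; first by rewrite -compA bi2 bi' compm1.
    by rewrite compA bd' -compA bd2 compA.
  have ve1 : ext_pull (v ∘ bin1 ZZ) e0 e1.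
    exists (b' ∘ b ∘ bin1 MM); split.
      have := congr1 (fun w => w ∘ bin1 XX) bi; rewrite -!compA.
      rewrite !compDl -!compA bpr1in1 bpr2in1 !compm1 !compm0 !addr0 => ->.
      by rewrite compm1 bi'.
    rewrite !compA bd' -(compA v) bd -!compA compDl -!compA bpr1in1 bpr2in1.
    by rewrite !compm1 !compm0 addr0.
  have ve2 : ext_pull (v ∘ bin2 ZZ) e0 e2.
    exists (b' ∘ b ∘ bin2 MM); split.
      have := congr1 (fun w => w ∘ bin2 XX) bi; rewrite -!compA.
      rewrite !compDl -!compA bpr1in2 bpr2in2 !compm1 !compm0 !add0r => ->.
      by rewrite compm1 bi'.
    rewrite !compA bd' -(compA v) bd -!compA compDl -!compA bpr1in2 bpr2in2.
    by rewrite !compm1 !compm0 add0r.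
  by rewrite (classifiedE ve) (classifiedE ve1) (classifiedE ve2) compDr stD dualD.
- move=> a e e' [b [bi bd]]; have [v [b' [bi' bd']]] := classifying_map e.
  have [v' [b'' [bi'' bd'']]] := classifying_map e'.
  rewrite (classifiedE (v := v') (e := e')); last by exists b''.
  rewrite (classifiedE (v := v) (e := e)); last by exists b'.
  rewrite -dualZ -stZ; congr (dfun psi _).
  apply: (completion_unique conf_kercoker (f := a *: idm E X) (g := b'' ∘ b)
    (g' := a *: b') (econf e) c0 injJ).
  + by rewrite -compA bi compA bi'' compm1.
  + by rewrite compA (bd'' : d0 ∘ b'' = _) -compA bd comp1m.
  + by rewrite compZl bi' compm1 compZr compm1.
  + by rewrite compZl compZr (bd' : d0 ∘ b' = _).
Qed.

End Form.
End AuslanderReitenTrace.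

Section ARPairing.
Variables (k : fieldType) (T : Type) (E : excat k T).
Hypothesis conf_kercoker : forall X Y Z (i : Hom E X Y) (p : Hom E Y Z),
  conflation E i p -> kercoker i p.
Hypothesis inj_extends : forall I, ext_injective E I -> extends_to E I.
Variables (tau : lfunctor (stab E) (stab E)) (S : suspension E).

(** The trace is the duality evaluated at the extension that defines the suspension
    of [tau f]. By naturality, evaluating at the pull-back of this extension along
    [v] amounts to composing with [v]. Every extension by [tau f] is such a
    pull-back, whence nondegeneracy on the left; on the right, every form [psi] is
    represented through its form on extensions, so a morphism [v] that is orthogonal
    to everything is killed by all forms, provided that the pull-back along [v]
    exists. *)
Lemma auslander_reiten_trace f : auslander_reiten_duality tau ->
  exists t : dual (Hom (stab E) f (susp S (tau f))),
    (forall g (x : Hom (stab E) f g),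
       (forall v : Hom (stab E) g (susp S (tau f)), t (v ∘ x) = 0) -> x = 0) /\
    (forall g (v : Hom E g (susp S (tau f))) (e : ext E g (tau f)),
       ext_pull v (Ext (sconf S (tau f))) e ->
       (forall x : Hom (stab E) f g, t (st v ∘ x) = 0) ->
       forall psi : dual (Hom (stab E) g (susp S (tau f))), psi (st v) = 0).
Proof.
move=> [Phi [PhiL PhiF PhiB PhiN]]; set H := susp S (tau f).
pose e0 : ext E H (tau f) := Ext (sconf S (tau f)).
have tlin : scalar (fun y : Hom (stab E) f H => Phi f H y e0).
  by move=> a x y; apply: PhiL.
have pullE g (x : Hom (stab E) f g) v (e : ext E g (tau f)) :
    ext_pull v e0 e -> Phi f g x e = Phi f H (st v ∘ x) e0.
  move=> ve; rewrite -[_ ∘ x]compm1; apply/esym.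
  apply: (PhiN f g f H (idm (stab E) f) v (idm E (tau f)) x e0 e e) => //.
    by rewrite fhom1.
  by exists (idm E _); split; rewrite ?comp1m ?compm1.
have injJ := @shull_injective _ _ _ S (tau f).
have class := classifying_map conf_kercoker inj_extends (sconf S (tau f)) injJ.
exists (Dual tlin); split=> /=.
- move=> g x tx.
  have [y [_ yP]] := PhiB f g _ (PhiF f g x); rewrite -(yP x) //.
  apply: yP => e; have [v ve] := class g e.
  have Phi0 : Phi f g 0 e = 0.
    by have := PhiL f g (-1) 0 0 e; rewrite scaler0 addr0 mulN1r addNr.
  by rewrite Phi0 (pullE _ _ _ _ ve) tx.
- move=> g v e ve tv psi.
  have form := classified_form conf_kercoker inj_extends (sconf S (tau f)) injJ psi.
  have [x [xP _]] := PhiB f g _ form.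
  have := xP e; rewrite (pullE _ _ _ _ ve) tv.
  by rewrite (classifiedE _ _ _ _ ve).
Qed.

End ARPairing.

Section CalabiYauTrace.
Variables (k : fieldType) (T : Type) (C : lincat k T) (Sh : lfunctor C C).
Hypothesis serre : serre_duality Sh.

(** Serre duality itself provides enough linear forms, namely [Phi] evaluated at the
    morphisms of the opposite direction. *)
Lemma hom_separated W A (v : Hom C W A) :
  (forall psi : dual (Hom C W A), psi v = 0) -> v = 0.
Proof.
move=> psi0; have [Phi [PhiL PhiB _]] := serre.
have Phi0 : Phi W A 0 = 0 by have := PhiL W A (-1) 0 0; rewrite !scaleN1r !addNr.
apply: (bij_inj (PhiB W A)); rewrite Phi0; apply: dualP => x.
have xlin : scalar (fun u => Phi W A u x) by move=> a u w; rewrite PhiL.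
exact: (psi0 (Dual xlin)).
Qed.

Lemma serre_duality_trace : exists t : forall Y, dual (Hom C Y (Sh Y)),
  (forall Y, serre_trace (t Y)) /\
  forall Y Z (p : Hom C Y Z) u, t Z (fhom Sh p ∘ u) = t Y (u ∘ p).
Proof.
have [Phi [PhiL PhiB PhiN]] := serre.
have PhiE Y W (u : Hom C Y W) x : Phi Y W u x = Phi Y Y (idm C Y) (x ∘ u).
  have := PhiN Y Y Y W (idm C Y) u (idm C Y) x.
  by rewrite !compm1 fhom1 comp1m.
exists (fun Y => Phi Y Y (idm C Y)); split=> [Y|Y Z p u].
  split=> W u tu.
    have Phi0 : Phi Y W 0 = 0 by have := PhiL Y W (-1) 0 0; rewrite !scaleN1r !addNr.
    by apply: (bij_inj (PhiB Y W)); rewrite Phi0; apply: dualP => x; rewrite PhiE tu.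
  apply: hom_separated => psi; have [g _ Phig] := PhiB Y W.
  by rewrite -[psi]Phig PhiE tu.
have := PhiN Z Z Y Z p (idm C Z) (idm C Z) u.
by rewrite !comp1m compm1 => <-; rewrite PhiE.
Qed.

End CalabiYauTrace.

Section SerreObject.
Variables (k : fieldType) (T : Type) (E : excat k T).
Local Notation M := (monocat E).
Hypothesis qE : quillen_exact E.
Hypothesis separated : forall W A (v : Hom (stab E) W A),
  (forall psi : dual (Hom (stab E) W A), psi v = 0) -> v = 0.

Section Pullbacks.
Variables (a : mono E) (J h : mono E) (i : Hom M a J) (d : Hom M J h).
Hypothesis c : conflation M i d.

(** The sources are pulled back in [E]. Since the quotient is an identity, the targets
    have to be the push-out of the sources along [marr a], which also makes the
    middle term an inflation. *)
Lemma diag_pullback W (w : Hom M (diag_mono qE W) h) :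
  exists e : ext M (diag_mono qE W) a, ext_pull w (Ext c) e.
Proof.
case: (c) => c1 c2; have kE := qe_kercoker qE.
have [Q1 [j1 [q1 [b1 [cj bj db]]]]] := pullback_conflation qE (on_src w) c1.
have j1P : inflation j1 by exists W, q1.
have [Q2 [g [j2 [po j2P]]]] := qe_pushout qE (marr a) j1P.
have [q2 [cj2 qg qj]] := pushout_conflation qE po cj.
have gP : inflation g by apply: pushout_inflation (pushout_sym po) (marrP a).
have [|b2 [bg bj2]] := pushout_desc (u := marr J ∘ b1) (v := on_tgt i) po.
  by rewrite -compA bj -(squareP i).
have einfP : j2 ∘ marr a = marr (Mono gP) ∘ j1 by rewrite /= (proj1 po).
have edefP : q2 ∘ marr (Mono gP) = marr (diag_mono qE W) ∘ q1 by rewrite /= comp1m.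
have bP : b2 ∘ marr (Mono gP) = marr J ∘ b1 by [].
have ce : conflation M (square (g := Mono gP) einfP)
                       (square (f := Mono gP) (g := diag_mono qE W) edefP) by [].
exists (Ext ce), (square (f := Mono gP) bP); split; apply: square_ext.
- by change (b1 ∘ j1 = on_src i ∘ idm E _); rewrite compm1.
- by change (b2 ∘ j2 = on_tgt i ∘ idm E _); rewrite compm1.
- exact: db.
- change (on_tgt d ∘ b2 = on_tgt w ∘ q2).
  apply: (pushout_joint_epi po); rewrite -!compA ?bg ?bj2 ?qg ?qj.
    rewrite compA squareP -compA db compA -(squareP w); congr (_ ∘ _).
    exact: compm1.
  by rewrite compm0 (conf0 kE c2).
Qed.

(** The sources form the trivial extension by a zero object, so the middle term is a
    composite of inflations. *)
Lemma zero_pullback O (O0 : is_zero E O) W (w : Hom M (zero_mono qE O0 W) h) :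
  exists e : ext M (zero_mono qE O0 W) a, ext_pull w (Ext c) e.
Proof.
case: (c) => c1 c2; have kE := qe_kercoker qE.
have [Q [j [q [b [cj bj db]]]]] := pullback_conflation qE (on_tgt w) c2.
have gP : inflation (j ∘ marr a) by apply: (qe_infM qE) (marrP a); exists W, q.
have einfP : j ∘ marr a = marr (Mono gP) ∘ idm E (msrc a) by rewrite compm1.
have edefP : q ∘ marr (Mono gP) = marr (zero_mono qE O0 W) ∘ (0 : Hom E (msrc a) O).
  by rewrite /= comp0m compA (conf0 kE cj) comp0m.
have bP : b ∘ marr (Mono gP) = marr J ∘ on_src i.
  by rewrite /= compA bj squareP.
have ce : conflation M (square (g := Mono gP) einfP)
                       (square (f := Mono gP) (g := zero_mono qE O0 W) edefP).
  by split=> //; apply: zero_conflation_right.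
exists (Ext ce), (square (f := Mono gP) bP); split; apply: square_ext.
- by [].
- by change (b ∘ j = on_tgt i ∘ idm E _); rewrite compm1.
- change (on_src d ∘ on_src i = on_src w ∘ 0).
  by rewrite compm0 (conf0 kE c1).
- exact: db.
Qed.

End Pullbacks.

Variables (tau : lfunctor (stab M) (stab M)) (S : suspension M).
Hypothesis ar : auslander_reiten_duality tau.

(** The trace of [f] is transported along the adjunctions of [diag_mono] and
    [zero_mono], which translate morphisms between [f] or [h] and these objects into
    morphisms of the stable category of [E]; a morphism into or out of [diag_mono W]
    or [zero_mono W] comes from its component there. The two traces are
    compatible because both sides evaluate the trace of [f] at the square with
    components [0] and [marr h ∘ u ∘ p]. *)
Lemma serre_object_trace f Z (p : Hom E (mtgt f) Z) :
  conflation E (marr f) p -> let h := susp S (tau f) in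
  exists (t1 : dual (Hom (stab E) (mtgt f) (msrc h)))
         (t2 : dual (Hom (stab E) Z (mtgt h))),
    [/\ serre_trace t1, serre_trace t2 &
        forall u, t2 (st (marr h) ∘ u) = t1 (u ∘ st p)].
Proof.
move=> pc h; have [O O0] := proj1 (qe_additive qE).
have [t [tL tR]] :=
  auslander_reiten_trace (@mono_kercoker _ _ _ qE)
    (@mono_injective_extends _ _ _ qE) S f ar.
pose s1 (u : Hom (stab E) (mtgt f) (msrc h)) : Hom (stab M) f h :=
  st (diag_counit qE h) ∘ fhom (stab_diag qE) u ∘ st (diag_unit qE f).
pose s2 (u : Hom (stab E) Z (mtgt h)) : Hom (stab M) f h :=
  st (zero_counit qE O0 h) ∘ fhom (stab_zero qE O0) u ∘ st (zero_unit qE O0 pc).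
have s1E u : s1 (st u) = st (diag_counit qE h ∘ diag_hom qE u ∘ diag_unit qE f).
  by rewrite /s1 stab_diagE !stM.
have s2E u : s2 (st u) = st (zero_counit qE O0 h ∘ zero_hom qE O0 u ∘ zero_unit qE O0 pc).
  by rewrite /s2 stab_zeroE !stM.
have lin1 : scalar (fun u => t (s1 u)).
  by move=> a u v; rewrite /s1 fhom_lin compDr compZr compDl compZl (dfunP t).
have lin2 : scalar (fun u => t (s2 u)).
  by move=> a u v; rewrite /s2 fhom_lin compDr compZr compDl compZl (dfunP t).
exists (Dual lin1), (Dual lin2); split.
- split=> W u'.
  + have [u ->] := st_surj u' => tu.
    have {}tu v : t (s1 (v ∘ st u)) = 0 := tu v.
    pose x := st (diag_hom qE u ∘ diag_unit qE f).
    suff x0 : x = 0.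
      have := congr1 (fun y => fhom (stab_tgt qE) y) x0; rewrite stab_tgtE fhom0.
      change (st (u ∘ idm E (mtgt f)) = 0 -> st u = 0).
      by rewrite compm1.
    apply: tL => w'; have [w ->] := st_surj w'.
    have wE : w = diag_counit qE h ∘ diag_hom qE (on_src w).
      apply: square_ext.
        by change (on_src w = idm E _ ∘ on_src w); rewrite comp1m.
      by change (on_tgt w = marr h ∘ on_src w); rewrite -squareP; apply/esym/compm1.
    rewrite /x -stM -(tu (st (on_src w))) -stM s1E; congr (dfun t (st _)).
    rewrite {1}wE; apply: square_ext.
      change (idm E _ ∘ on_src w ∘ (u ∘ marr f) = idm E _ ∘ (on_src w ∘ u) ∘ marr f).
      by rewrite !compA.
    change (marr h ∘ on_src w ∘ (u ∘ idm E _) = marr h ∘ (on_src w ∘ u) ∘ idm E _).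
    by rewrite !compA.
  + have [v ->] := st_surj u' => tv.
    have {}tv u : t (s1 (st v ∘ u)) = 0 := tv u.
    pose w := diag_counit qE h ∘ diag_hom qE v.
    have [e we] := diag_pullback (sconf S (tau f)) w.
    suff /(tR _ _ _ we) w0 : forall x : Hom (stab M) f _, t (st w ∘ x) = 0.
      apply: separated => psi.
      have psilin : scalar (fun y : Hom (stab M) (diag_mono qE W) h =>
          psi (fhom (stab_src qE) y)).
        by move=> a y z; rewrite fhom_lin (dfunP psi).
      have := w0 (Dual psilin).
      change (psi (fhom (stab_src qE) (st w)) = 0 -> psi (st v) = 0).
      rewrite stab_srcE => <-.
      by congr (dfun psi (st _)); apply/esym/comp1m.
    move=> x'; have [x ->] := st_surj x'.
    pose x2 : Hom E (mtgt f) W := on_tgt x.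
    rewrite -stM -(tv (st x2)) -stM s1E; congr (dfun t (st _)); apply: square_ext.
      change (idm E _ ∘ v ∘ (on_src x : Hom E _ W) = idm E _ ∘ (v ∘ x2) ∘ marr f).
      have -> : on_src x = x2 ∘ marr f by rewrite /x2 (squareP x); apply/esym/comp1m.
      by rewrite !compA.
    change (marr h ∘ v ∘ x2 = marr h ∘ (v ∘ x2) ∘ idm E _).
    by rewrite compm1 !compA.
- split=> W u'.
  + have [u ->] := st_surj u' => tu.
    have {}tu v : t (s2 (v ∘ st u)) = 0 := tu v.
    pose x := zero_hom qE O0 u ∘ zero_unit qE O0 pc.
    suff /st_eq0 nx : st x = 0.
      apply/st_eq0; apply: (null_cokernel qE pc _ _ nx).
        exact: (zero_conflation_left qE W O0).
      by rewrite comp1m.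
    apply: tL => w'; have [w ->] := st_surj w'.
    have wE : w = zero_counit qE O0 h ∘ zero_hom qE O0 (on_tgt w).
      apply: square_ext; first exact: (etrans (proj1 O0 _ _) (esym (proj1 O0 _ _))).
      by change (on_tgt w = idm E _ ∘ on_tgt w); rewrite comp1m.
    pose w2 : Hom E W (mtgt h) := on_tgt w.
    rewrite /x -stM -(tu (st w2)) -stM s2E; congr (dfun t (st _)).
    rewrite wE; apply: square_ext.
      change ((0 : Hom E O (msrc h)) ∘ idm E O ∘ (idm E O ∘ (0 : Hom E (msrc f) O))
              = (0 : Hom E O (msrc h)) ∘ idm E O ∘ (0 : Hom E (msrc f) O)).
      by rewrite !comp0m.
    change (idm E _ ∘ w2 ∘ (u ∘ p) = idm E _ ∘ (w2 ∘ u) ∘ p).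
    by rewrite !compA.
  + have [v ->] := st_surj u' => tv.
    have {}tv u : t (s2 (st v ∘ u)) = 0 := tv u.
    pose w := zero_counit qE O0 h ∘ zero_hom qE O0 v.
    have [e we] := zero_pullback (sconf S (tau f)) w.
    suff /(tR _ _ _ we) w0 : forall x : Hom (stab M) f _, t (st w ∘ x) = 0.
      apply: separated => psi.
      have psilin : scalar (fun y : Hom (stab M) (zero_mono qE O0 W) h =>
          psi (fhom (stab_tgt qE) y)).
        by move=> a y z; rewrite fhom_lin (dfunP psi).
      have := w0 (Dual psilin).
      change (psi (fhom (stab_tgt qE) (st w)) = 0 -> psi (st v) = 0).
      rewrite stab_tgtE => <-.
      by congr (dfun psi (st _)); apply/esym/comp1m.
    move=> x'; have [x ->] := st_surj x'.
    have [|u up] := cokernel_desc (f := on_tgt x : Hom E (mtgt f) W)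
      (proj2 (qe_kercoker qE pc)).
      by apply: etrans (squareP x) _; apply: comp0m.
    rewrite -stM -(tv (st u)) -stM s2E.
    congr (dfun t (st _)); apply: square_ext.
      change ((0 : Hom E O (msrc h)) ∘ idm E O ∘ (on_src x : Hom E _ O)
              = (0 : Hom E O (msrc h)) ∘ idm E O ∘ (0 : Hom E (msrc f) O)).
      by rewrite !comp0m.
    change (idm E _ ∘ v ∘ (on_tgt x : Hom E _ W) = idm E _ ∘ (v ∘ u) ∘ p).
    by rewrite -up !compA.
- move=> u'; have [u ->] := st_surj u'; rewrite -!stM.
  change (t (s2 (st (marr h ∘ u))) = t (s1 (st (u ∘ p)))); rewrite s1E s2E.
  congr (dfun t (st _)); apply: square_ext.
    change ((0 : Hom E O (msrc h)) ∘ idm E O ∘ (0 : Hom E (msrc f) O)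
            = idm E _ ∘ (u ∘ p) ∘ marr f).
    by rewrite !comp0m -!compA (conf0 (qe_kercoker qE) pc) !compm0.
  change (idm E _ ∘ (marr h ∘ u) ∘ p = marr h ∘ (u ∘ p) ∘ idm E _).
  by rewrite comp1m compm1 !compA.
Qed.

End SerreObject.

Lemma stab_hom_finite (k : fieldType) (T : Type) (E : excat k T) :
  hom_finite E -> hom_finite (stab E).
Proof.
move=> fin X Y; have [n [b bP]] := fin X Y; exists n, (fun j => st (b j)) => q.
have [f ->] := st_surj q; have [c ->] := bP f; exists c.
elim: (index_enum _) => [|j r IH]; first by rewrite !big_nil st0.
by rewrite !big_cons stD stZ IH.
Qed.

(** * The sixth power of the translation *)

Section SixthPower.
Variables (k : fieldType) (T : Type) (E : excat k T).
Local Notation M := (monocat E).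
Hypotheses (qE : quillen_exact E) (enough : enough_injectives E).
Hypothesis fin : hom_finite E.
Variables (d : int) (S0 : suspension E) (S : suspension M).
Variable tau : lfunctor (stab M) (stab M).
Hypotheses (serre : serre_duality (shift S0 d)) (ar : auslander_reiten_duality tau).
Local Notation "X ~ Y" := (isomorphic (stab M) X Y) (at level 70).
Local Notation rotate := (rotate qE enough).

(** Both objects are models of the image of the cokernel of [f] under the Serre
    functor [shift S0 d], by uniqueness of Serre objects. *)
Lemma susp_tau f : susp S (tau f) ~ shift S d (rotate f).
Proof.
apply: (arr_iso_iso qE); apply: arr_iso_trans _ (arr_iso_sym (shift_arrow qE S S0 _ _)).
have [Z [p [pc pr]]] := rotateP qE enough f.
apply: arr_iso_trans _ (fhom_arr_iso (shift S0 d) pr).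
have [t [tP tN]] := serre_duality_trace serre.
have [s1 [s2 [s1P s2P sN]]] := serre_object_trace qE (hom_separated serre) S ar pc.
exact: (serre_arr_iso (stab_hom_finite fin) s1P s2P (tP _) (tP _) sN (tN _ _ _)).
Qed.

Lemma tau_rotate f : tau f ~ shift S (d - 1) (rotate f).
Proof.
apply: iso_trans (iso_sym (desusp_susp S _)) _.
apply: iso_trans (fob_iso _ (susp_tau f)) _.
exact/iso_sym/shift_pred.
Qed.

Lemma rotate_shift n f : rotate (shift S n f) ~ shift S n (rotate f).
Proof.
have rotate_desusp g : rotate (desusp S g) ~ desusp S (rotate g).
  apply: iso_trans (iso_sym (desusp_susp S _)) _; apply: fob_iso.
  apply: iso_trans (iso_sym (rotate_susp qE enough S _)) _.
  exact/rotate_iso/susp_desusp.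
elim/int_ind: n f => [|n IH|n IH] f; first exact: iso_refl.
  rewrite -addn1 PoszD.
  apply: iso_trans (rotate_iso qE enough (shift_succ _ _ _)) _.
  apply: iso_trans (rotate_susp qE enough S _) _.
  exact: iso_trans (fob_iso _ (IH f)) (iso_sym (shift_succ _ _ _)).
rewrite -addn1 PoszD opprD.
apply: iso_trans (rotate_iso qE enough (shift_pred _ _ _)) _.
apply: iso_trans (rotate_desusp _) _.
exact: iso_trans (fob_iso _ (IH f)) (iso_sym (shift_pred _ _ _)).
Qed.

Lemma tau_iter n f : fiter n tau f ~ shift S (n%:Z * (d - 1)) (iter n rotate f).
Proof.
elim: n => [|n IH]; first by rewrite mul0r; apply: iso_refl.
apply: iso_trans (fob_iso tau IH) _; apply: iso_trans (tau_rotate _) _.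
apply: iso_trans (fob_iso _ (rotate_shift _ _)) _.
apply: iso_trans (iso_sym (shiftD _ _ _ _)) _.
by rewrite -addn1 PoszD mulrDl mul1r addrC addn1; apply: iso_refl.
Qed.

Lemma tau6 f : fiter 6 tau f ~ shift S (6 * d - 4) f.
Proof.
apply: iso_trans (tau_iter 6 f) _.
have -> : 6 * d - 4 = 6%:Z * (d - 1) + 2.
  by rewrite mulrBr mulr1 -addrA.
apply: iso_trans _ (iso_sym (shiftD _ _ _ _)); apply: fob_iso.
apply: iso_trans (rotate_cube qE enough S _) _; apply: fob_iso.
exact: rotate_cube.
Qed.

End SixthPower.

Theorem theoremB (k : fieldType) (T : Type) (V : lincat k T)
    (P : {F : cofun V | finitely_presented F} -> Prop) (d : int)
    (C := full_excat (kercoker_excat (fpmod V)) P)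
    (tau : lfunctor (stab (monocat C)) (stab (monocat C)))
    (S : suspension (monocat C)) (f : mono C) :
  dualizing_variety V ->
  exact_subcategory (kercoker_excat (fpmod V)) P ->
  functorially_finite (fpmod V) P ->
  krull_schmidt C ->
  stably_calabi_yau C d ->
  auslander_reiten_translation tau ->
  isomorphic (stab (monocat C)) (fiter 6 tau f) (shift S (6 * d - 4) f).
Proof.
move=> _ _ _ _ [fin [[qE _ enough _] [S0 serre]]] [_ ar].
exact: (tau6 qE enough fin S serre ar).
Qed.
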